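(* Suppose Assumptions 1–4 below hold. Run Algorithm 2Direction with $$\bar L=660508\cdot\max\Big\{\frac L\alpha,\frac{Lp}{\alpha\tau},\frac{\sqrt{LL_{\max}}\,p\sqrt{\omega\tau}}{\alpha\beta\sqrt n},\frac{\sqrt{LL_{\max}}\sqrt p\sqrt{\omega\tau}}{\alpha\sqrt\beta\sqrt n},\frac{L_{\max}\omega p^2}{\beta^2n},\frac{L_{\max}\omega}{n}\Big\},$$ $\beta\le\frac1{\omega+1}$, and $\theta_{\min}=\frac14\min\{1,\frac\alpha p,\frac\tau p,\frac\beta p\}$. Then there exist constants $\kappa,\rho,\lambda\ge0$ and nonnegative reals $(\nu_t)_{t\ge0}$ such that for all $t\ge0$, writing $$\Psi_t=\mathbb E[f(z^t)-f(x^* )]+\kappa\,\mathbb E\Big[\frac1n\sum_{i=1}^n\|h_i^t-\nabla f_i(z^t)\|^2\Big]+\nu_t\,\mathbb E\|w^t-u^t\|^2+\rho\,\mathbb E\|k^t-\nabla f(z^t)\|^2+\lambda\,\mathbb E\|v^t-\nabla f(z^t)\|^2,$$ we have $$\Gamma_{t+1}\Psi_{t+1}+\frac{\bar L+\Gamma_{t+1}\mu}{2}\mathbb E\|u^{t+1}-x^*\|^2\le\Gamma_t\Psi_t+\frac{\bar L+\Gamma_t\mu}{2}\mathbb E\|u^t-x^*\|^2.$$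
   Context: Setting: $f=\frac1n\sum_{i=1}^nf_i$, $f_i:\mathbb R^d\to\mathbb R$. Assumption 1: each $f_i$ is $L_i$-smooth, $L_{\max}=\max_iL_i$, and $\widehat L>0$ satisfies $\frac1n\sum_i\|\nabla f_i(x)-\nabla f_i(y)\|^2\le\widehat L^2\|x-y\|^2$ for all $x,y$. Assumption 2: $f$ is $L$-smooth. Assumption 3: each $f_i$ is convex and $f$ is $\mu$-strongly convex ($\mu\ge0$) with minimizer $x^*$. Assumption 4: the randomness of all compressors is drawn independently (of each other, of the coins $c^t$, and of the past). Compressor classes: $\mathbb U(\omega)$ ($\omega\ge0$) = stochastic maps $\mathcal C$ with $\mathbb E\mathcal C(x)=x$, $\mathbb E\|\mathcal C(x)-x\|^2\le\omega\|x\|^2$; $\mathbb B(\alpha)$ ($\alpha\in(0,1]$) = possibly stochastic maps with $\mathbb E\|\mathcal C(x)-x\|^2\le(1-\alpha)\|x\|^2$. Algorithm 2Direction: compressors $\mathcal C_i^{D,y},\mathcal C_i^{D,z}\in\mathbb U(\omega)$ (workers), $\mathcal C^P\in\mathbb B(\alpha)$ (server); parameters $\bar L>0$, $\mu\ge0$ (the strong convexity constant), $p\in(0,1]$, $\Gamma_0\ge1$, $\tau\in(0,1]$, $x^0,h_1^0,\dots,h_n^0,k^0,v^0\in\mathbb R^d$. Set $\beta=1/(\omega+1)$, $w^0=z^0=u^0=x^0$, $h^0=\frac1n\sum_ih_i^0$. For $t=0,1,\dots$: let $\bar\theta_{t+1}$ be the largest root of $p\bar L\Gamma_t\theta^2+p(\bar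 L+\Gamma_t\mu)\theta-(\bar L+\Gamma_t\mu)=0$, $\theta_{t+1}=\min\{\bar\theta_{t+1},\theta_{\min}\}$, $\gamma_{t+1}=p\theta_{t+1}\Gamma_t/(1-p\theta_{t+1})$, $\Gamma_{t+1}=\Gamma_t+\gamma_{t+1}$; $y^{t+1}=\theta_{t+1}w^t+(1-\theta_{t+1})z^t$; $m_i^{t,y}=\mathcal C_i^{D,y}(\nabla f_i(y^{t+1})-h_i^t)$; $g^{t+1}=h^t+\frac1n\sum_im_i^{t,y}$; $u^{t+1}=\arg\min_x\{\langle g^{t+1},x\rangle+\frac{\bar L+\Gamma_t\mu}{2\gamma_{t+1}}\|x-u^t\|^2+\frac\mu2\|x-y^{t+1}\|^2\}$; $q^{t+1}=\arg\min_x\{\langle k^t,x\rangle+\frac{\bar L+\Gamma_t\mu}{2\gamma_{t+1}}\|x-w^t\|^2+\frac\mu2\|x-y^{t+1}\|^2\}$; $w^{t+1}=q^{t+1}+\mathcal C^P(u^{t+1}-q^{t+1})$; $x^{t+1}=\theta_{t+1}u^{t+1}+(1-\theta_{t+1})z^t$; draw $c^t\sim\mathrm{Bernoulli}(p)$, and set $(k^{t+1},z^{t+1})=(v^t,x^{t+1})$ if $c^t=1$, $(k^{t+1},z^{t+1})=(k^t,z^t)$ if $c^t=0$; $m_i^{t,z}=\mathcal C_i^{D,z}(\nabla f_i(z^{t+1})-h_i^t)$; $h_i^{t+1}=h_i^t+\beta m_i^{t,z}$; $v^{t+1}=(1-\tau)v^t+\tau(h^t+\frac1n\sum_im_i^{t,z})$;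 $h^{t+1}=h^t+\frac\beta n\sum_im_i^{t,z}$. $\mathbb E$ is full expectation. *)

(* Defs.v *)
From HB Require Import structures.
From mathcomp Require Import all_boot all_order all_algebra.
From mathcomp Require Import all_classical all_reals all_analysis.

Set Implicit Arguments.
Unset Strict Implicit.
Unset Printing Implicit Defensive.

Import Order.TTheory GRing.Theory Num.Theory.
Local Open Scope classical_set_scope.
Local Open Scope ring_scope.

Definition vec (R : realType) (d : nat) := 'rV[R]_d.
HB.instance Definition _ (R : realType) d := GRing.Lmodule.on (vec R d).
HB.instance Definition _ (R : realType) d :=
  isPointed.Build (vec R d) (0 : 'rV[R]_d).

Definition coord (R : realType) d (x : vec R d) (j : 'I_d) : R :=
  (x : 'M[R]_(1, d)) ord0 j.

Definition dot (R : realType) d (x y : vec R d) : R :=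
  \sum_(j < d) coord x j * coord y j.
Definition sqnorm (R : realType) d (x : vec R d) : R := dot x x.
Definition enorm (R : realType) d (x : vec R d) : R := Num.sqrt (sqnorm x).

(* Borel sigma-algebra of R^d: generated by the coordinate maps. *)
Definition coord_sets (R : realType) d : set (set (vec R d)) :=
  [set A | exists (j : 'I_d) (B : set R), measurable B /\
                                          A = (fun x => coord x j) @^-1` B].
Definition vecm (R : realType) d := g_sigma_algebraType (@coord_sets R d).

(* g is the gradient of f: for all x and directions v, the derivative of
   s |-> f (x + s v) at s = 0 exists and equals <g x, v>.  Together with the
   Lipschitz continuity of g required by smoothness, this is the usual
   (Frechet) gradient. *)
Definition is_gradient (R : realType) d (f : vec R d -> R) (g : vec R d -> vec R d) :=
  forall x v : vec R d,
    is_derive (0 : R) (1 : R) (fun s : R => f (x + s *: v)) (dot (g x) v).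

Definition smooth_with (R : realType) d (L : R) (f : vec R d -> R)
    (g : vec R d -> vec R d) :=
  is_gradient f g /\ forall x y, enorm (g x - g y) <= L * enorm (x - y).

Definition convex_fun (R : realType) d (f : vec R d -> R) :=
  forall (x y : vec R d) (l : R), 0 <= l <= 1 ->
    f (l *: x + (1 - l) *: y) <= l * f x + (1 - l) * f y.

Definition strongly_convex (R : realType) d (mu : R) (f : vec R d -> R) :=
  forall (x y : vec R d) (l : R), 0 <= l <= 1 ->
    f (l *: x + (1 - l) *: y)
      <= l * f x + (1 - l) * f y - mu / 2 * l * (1 - l) * sqnorm (x - y).

Section Prob.
Context (R : realType) (dT : measure_display) (T : measurableType dT)
        (P : probability T R).

Definition Expect (X : T -> R) : \bar R := (\int[P]_w (X w)%:E)%E.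

Definition sub_sigma (F : set (set T)) :=
  sigma_algebra setT F /\ F `<=` measurable.

Definition mutually_independent (J : Type) (F : J -> set (set T)) :=
  forall (m : nat) (idx : 'I_m -> J), injective idx ->
  forall A : 'I_m -> set T, (forall k, F (idx k) (A k)) ->
    P (\bigcap_(k in [set: 'I_m]) A k) = (\prod_(k < m) P (A k))%E.

(* A random map C : T -> R^d -> R^d whose randomness lives in the
   sub-sigma-algebra F: it is jointly measurable in (omega, x) for F (x) Borel. *)
Definition random_map_in d (F : set (set T)) (C : T -> vec R d -> vec R d) :=
  forall j : 'I_d,
    measurable_fun setT
      (fun p : (g_sigma_algebraType F * vecm R d)%type => coord (C p.1 p.2) j).

Definition in_U d (om : R) (C : T -> vec R d -> vec R d) :=
  forall x : vec R d,
    (forall j, P.-integrable setT (fun w => (coord (C w x) j)%:E) /\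
               (\int[P]_w (coord (C w x) j)%:E = (coord x j)%:E)%E) /\
    (Expect (fun w => sqnorm (C w x - x)%R) <= (om * sqnorm x)%:E)%E.

Definition in_B d (al : R) (C : T -> vec R d -> vec R d) :=
  forall x : vec R d,
    (Expect (fun w => sqnorm (C w x - x)%R) <= ((1 - al) * sqnorm x)%:E)%E.

End Prob.

(* Sources of randomness of Algorithm 2Direction *)
Inductive src (n : nat) : Type :=
| SrcDy of nat & 'I_n    (* C_i^{D,y} used at iteration t *)
| SrcDz of nat & 'I_n    (* C_i^{D,z} used at iteration t *)
| SrcP of nat            (* C^P used at iteration t *)
| SrcCoin of nat.        (* the coin c^t *)

Definition favg (R : realType) n d (f : 'I_n -> vec R d -> R) (x : vec R d) : R :=
  n%:R^-1 * \sum_(i < n) f i x.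
Definition gavg (R : realType) n d (g : 'I_n -> vec R d -> vec R d)
    (x : vec R d) : vec R d :=
  n%:R^-1 *: \sum_(i < n) g i x.

Definition Lmax_of (R : realType) n (Li : 'I_n -> R) : R :=
  \big[Num.max/0]_(i < n) Li i.

(* the objective  <gv, x> + A/(2 gam) ||x - anchor||^2 + mu/2 ||x - yv||^2
   minimised in the u- and q-steps of Algorithm 2Direction *)
Definition prox_obj (R : realType) d (gv : vec R d) (A gam mu : R)
    (anchor yv x : vec R d) : R :=
  dot gv x + A / (2 * gam) * sqnorm (x - anchor) + mu / 2 * sqnorm (x - yv).

(* Main.v *)
(* The sources of randomness are independent of each other and of the past, so the expectation
   over a fresh source can be taken with everything drawn before frozen (Tonelli on the product
   of the two sigma-algebras).  An unbiased compressor thus adds only its variance to a squared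
   norm, a biased one contracts it, and the coin averages its two outcomes.  This is applied
   to squared norms only, so no signed conditional expectation is needed: the linear term
   [<gradient, u^{t+1} - xstar>] of the descent inequality is completed to a square by comparing
   [u^{t+1}] with the minimizer of the model built from the exact gradient.

   One iteration then gives linear inequalities between the expectations of
   [F = f(z) - f(xstar)], [H = 1/n sum |h_i - grad f_i(z)|^2], [K = |k - grad f(z)|^2],
   [V = |v - grad f(z)|^2], [W = |w - u|^2], [U = |u^{t+1} - u^t|^2], [S = |u^{t+1} - w^t|^2]
   and the Bregman divergence [D = D_f(z^t, y^{t+1})].  The terms in [S <= 2U + 2W] and [D] are
   paid for by the negative terms [- pLbar theta^2/2 U] and [- p(1 - theta) D] of the descent
   inequality and by the contraction of [W].  The constants are
   [nu_t = 8 L/alpha p theta_{t+1}^2], [rho = 64 L/(alpha Lbar)^2], [lambda = 8 p rho/tau] and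
   [kappa = (16 p omega/(n Lbar) + 4096 p tau L omega/(n (alpha Lbar)^2))/beta]; they only
   require the constant of [Lbar] to be at least [10^4]. *)
Require Import Defs.
From HB Require Import structures.
From mathcomp Require Import all_boot all_order all_algebra.
From mathcomp Require Import all_classical all_reals all_analysis.
From mathcomp Require Import measurable_realfun zify ring lra.

Import Order.TTheory GRing.Theory Num.Theory.
Import numFieldNormedType.Exports.
Local Open Scope classical_set_scope.
Local Open Scope ring_scope.

Set Implicit Arguments.
Unset Strict Implicit.
Unset Printing Implicit Defensive.

(* [all_algebra] shadows it with the coordinate function of [vector]. *)
Local Notation coord := Defs.coord.

(** * Independence of the sources of randomness *)

(** The constants solve a triangular system. In one step [H], [V], [W] contract at the rates beta/2,
    tau/2, alpha/2 and [K] at the rate p. As Gamma_t = (1 - p theta_{t+1}) Gamma_{t+1}, the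
    potential must shrink by the factor 1 - p theta_{t+1}; theta_min makes p theta_{t+1} at most a
    quarter of each of beta, tau, alpha, p, so that beta/4, tau/4, alpha/4 and 3p/4 remain to pay
    debts. Then alpha/4 nu_t pays the [W] hidden in [S], rho the [K] fed into [W] by the u- and
    q-steps, lambda the [V] copied into [K] by the coin, and kappa the [H] that the compression
    noise brings into the descent inequality, [V] and [W]. Only multiples of [S] and [D] are left;
    the members of the maximum in Lbar are the ratios that make them small. Two points shape the
    argument. The iterates u^{t+1} and x^{t+1} share the noise of g^{t+1}, so [S] is split pathwise
    into [U] and [W] instead of being conditioned on the past. And nu_{t+1} is built from
    theta_{t+2}, so theta has to be nonincreasing, which comes from the monotonicity of the root in
    Gamma_t. *)

Section Filtration.
Context (R : realType) (dT : measure_display) (T : measurableType dT).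
Context (P : probability T R) (J : Type) (F : J -> set (set T)).
Context (rank : J -> nat).
Hypothesis hF : forall j, sub_sigma (F j).
Hypothesis hI : mutually_independent P F.

(* [rank] orders the sources chronologically: a source is drawn once all sources of smaller
   rank are known. *)
Definition past (r : nat) : set (set T) :=
  [set A | exists2 j, (rank j < r)%N & F j A].

Local Notation pastT r := (g_sigma_algebraType (past r)).
Local Notation srcT j := (g_sigma_algebraType (F j)).

Lemma srcT_measurable j (A : set T) :
  measurable (A : set (srcT j)) <-> F j A.
Proof.
have [sF _] := hF j.
by rewrite -[X in _ <-> X _](measurable_g_measurableTypeE sF).
Qed.

Lemma srcT_sub j (A : set T) : measurable (A : set (srcT j)) -> measurable A.
Proof. by move/srcT_measurable; apply: (hF j).2. Qed.

Lemma pastT_sub r (A : set T) : measurable (A : set (pastT r)) -> measurable A.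
Proof.
apply: (@smallest_sub _ _ _ measurable); first exact: sigma_algebra_measurable.
by move=> B [j _]; apply: (hF j).2.
Qed.

Lemma pastT_le r r' (A : set T) : (r <= r')%N ->
  measurable (A : set (pastT r)) -> measurable (A : set (pastT r')).
Proof.
move=> rr'; apply: sub_sigma_algebra2 => B [j jr FB]; exists j => //.
exact: leq_trans jr rr'.
Qed.

Lemma srcT_past j r (A : set T) : (rank j < r)%N ->
  measurable (A : set (srcT j)) -> measurable (A : set (pastT r)).
Proof.
by move=> jr /srcT_measurable FA; apply: sub_sigma_algebra; exists j.
Qed.

Lemma F_setT j : F j setT.
Proof. by apply/srcT_measurable; exact: measurableT. Qed.

Lemma F_setI j (A B : set T) : F j A -> F j B -> F j (A `&` B).
Proof.
by move=> /srcT_measurable mA /srcT_measurable mB; apply/srcT_measurable/measurableI.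
Qed.

(** Lists without repetition replace injective families of indices; [{classic J}] supplies the
    decidable equality that [uniq] needs. *)
Lemma indep_seq (s : seq {classic J}) (A : J -> set T) : uniq s ->
  (forall j, F j (A j)) ->
  P (\bigcap_(j in [set` s]) A j) = (\prod_(j <- s) P (A j))%E.
Proof.
move=> us FA; pose idx := fun k : 'I_(size s) => tnth (in_tuple s) k : J.
have inj : injective idx.
  by apply/(@tuple_uniqP _ _ (in_tuple s)).
have := hI inj (fun k => FA (idx k)).
rewrite (_ : \bigcap_(k in _) _ = \bigcap_(j in [set` s]) A j); last first.
  apply/seteqP; split=> x H j /=.
    move=> js; have js' : (index (j : {classic J}) s < size s)%N by rewrite index_mem.
    have := H (Ordinal js') I; rewrite /idx (tnth_nth j)/= nth_index//.
  by move=> _; apply: H => /=; rewrite mem_tnth.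
by move=> ->; rewrite [RHS]big_tnth.
Qed.

(** Dynkin's pi-lambda theorem: the finite intersections of events from sources of rank below [r]
    form a pi-system that generates the past, and the events independent of [A] form a
    lambda-system. Such an intersection does not involve [j], whose rank is at least [r]. *)
Lemma indep_past j r (A B : set T) : (r <= rank j)%N -> F j A ->
  measurable (B : set (pastT r)) -> P (A `&` B) = (P A * P B)%E.
Proof.
move=> rj FA mB.
have mA : measurable A by exact: (hF j).2.
pose G : set (set T) := [set B | exists (s : seq {classic J}) (A : J -> set T),
  [/\ forall k : {classic J}, k \in s -> (rank k < r)%N, forall j, F j (A j) &
    B = \bigcap_(j in [set` s]) A j]].
pose H : set (set T) := [set B | measurable B /\ P (A `&` B) = (P A * P B)%E].
suff : <<s G >> `<=` H.
  move=> GH; have [] // := GH B _; apply: sub_sigma_algebra2 mB => C [k kr FC].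
  exists [:: (k : {classic J})], (fun i => if ((i : {classic J}) == k) then C else setT).
  split.
  - by move=> i; rewrite inE => /eqP ->.
  - by move=> i; case: eqP => [->//|_]; exact: F_setT.
  - rewrite set_cons1 bigcap_set1 eqxx//.
apply: lambda_system_subset => //.
- move=> _ _ [s1 [A1 [r1 F1 ->]]] [s2 [A2 [r2 F2 ->]]].
  (* A source present in both lists contributes the intersection of its two events; [setT] stands in
     for a source missing from a list. *)
  exists (s1 ++ s2), (fun j => (if (j : {classic J}) \in s1 then A1 j else setT) `&`
    (if (j : {classic J}) \in s2 then A2 j else setT)); split.
  + by move=> k; rewrite mem_cat => /orP[/r1|/r2].
  + by move=> k; apply: F_setI; case: ifP => _ //; exact: F_setT.
  + apply/seteqP; split=> x.
      move=> [H1 H2] k /= _; split; case: ifP => // ks; [exact: H1|exact: H2].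
    move=> H0; split=> k /= ks; have := H0 k; rewrite /= mem_cat ks ?orbT/=.
      by move=> /(_ isT) [].
    by move=> /(_ isT) [].
- apply/dynkin_lambda_system; split.
  + by split => //; rewrite setIT probability_setT mule1.
  + move=> C [mC PC]; split; first exact: measurableC.
    have fA : P A \is a fin_num by rewrite fin_num_measure.
    have fC : P C \is a fin_num by rewrite fin_num_measure.
    rewrite probability_setC// -setDE measureD//; last first.
      by rewrite ltey_eq fA.
    rewrite [X in (_ - X)%E]PC muleBr// mule1//.
  + move=> E tE HE; split.
      by apply: bigcupT_measurable => i; have [] := HE i.
    rewrite setI_bigcupr measure_semi_bigcup//; last 3 first.
    * by move=> i; apply: measurableI => //; have [] := HE i.
    * apply/trivIsetP => i k _ _ ik; have /trivIsetP/(_ i k I I ik) := tE.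
      by rewrite setIACA setIid => ->; rewrite setI0.
    * by apply: bigcupT_measurable => i; apply: measurableI => //; have [] := HE i.
    rewrite [X in (_ * X)%E]measure_semi_bigcup//; last 2 first.
    * by move=> i; have [] := HE i.
    * by apply: bigcupT_measurable => i; have [] := HE i.
    rewrite -(fineK (fin_num_measure P A mA)) -nneseriesZl//.
    rewrite (fineK (fin_num_measure P A mA)).
    by apply: eq_eseriesr => i _; exact: (HE i).2.
- move=> C [s [A' [rs FA' ->]]].
  rewrite /H /=; split.
    rewrite bigcap_seq; elim: (s) => [|a l IH]; first by rewrite big_nil.
    by rewrite big_cons; apply: measurableI => //; exact: (hF _).2.
  (* Independence concerns distinct sources, so repetitions are removed before [j] is put in
     front. *)
  set us := undup s.
  have -> : [set` s] = [set` us] by apply/seteqP; split=> x /=; rewrite mem_undup.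
  have jus : (j : {classic J}) \notin us.
    by rewrite mem_undup; apply/negP => /rs; rewrite ltnNge rj.
  pose A2 := fun i => if (i : {classic J}) == j then A else A' i.
  have e (i : {classic J}) : i \in us -> A2 i = A' i.
    by rewrite /A2; case: eqP => // ->; rewrite (negPf jus).
  have FA2 i : F i (A2 i) by rewrite /A2; case: eqP => [->|].
  have := @indep_seq ((j : {classic J}) :: us) A2.
  rewrite /= jus undup_uniq => /(_ isT FA2).
  rewrite bigcap_seq !big_cons {1 2}/A2 eqxx -bigcap_seq -indep_seq ?undup_uniq//.
  rewrite (_ : \bigcap_(i in [set` us]) A2 i = \bigcap_(i in [set` us]) A' i).
    by rewrite /A2 eqxx.
  by apply: eq_bigcapr => i /= /e.
Qed.

End Filtration.

(** * Integrating a fresh source with the past frozen *)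

Section Decoupling.
Context (R : realType) (dT : measure_display) (T : measurableType dT).
Context (P : probability T R) (J : Type) (F : J -> set (set T)).
Context (rank : J -> nat).
Hypothesis hF : forall j, sub_sigma (F j).
Hypothesis hI : mutually_independent P F.
Local Notation pastT r := (g_sigma_algebraType (past F rank r)).
Local Notation srcT j := (g_sigma_algebraType (F j)).

Variables (j : J) (r : nat).
Hypothesis rj : (r <= rank j)%N.

(** The identity of [T], seen as a map onto each of the two coarser sigma-algebras: its image laws
    are restrictions of [P], and [diag] carries their joint law. *)
Let to_src : T -> srcT j := id.
Let to_past : T -> pastT r := id.
Let diag : T -> (srcT j * pastT r)%type := fun s => (s, s).

Let m_src : measurable_fun setT to_src.
Proof. by move=> _ A mA; rewrite setTI; exact: (srcT_sub hF mA). Qed.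

Let m_past : measurable_fun setT to_past.
Proof. by move=> _ A mA; rewrite setTI; exact: (pastT_sub hF mA). Qed.

Let m_diag : measurable_fun setT diag.
Proof. by apply/measurable_fun_pairP; split; [exact: m_src|exact: m_past]. Qed.

HB.instance Definition _ := isMeasurableFun.Build _ _ _ _ to_src m_src.
HB.instance Definition _ := isMeasurableFun.Build _ _ _ _ to_past m_past.
HB.instance Definition _ := isMeasurableFun.Build _ _ _ _ diag m_diag.

Variable psi : (srcT j * pastT r)%type -> \bar R.
Hypothesis mpsi : measurable_fun setT psi.
Hypothesis psi0 : forall x, (0 <= psi x)%E.

Let innerE (s : T) : (\int[distribution P to_src]_s' psi (s', s) =
  \int[P]_s' psi (s', s))%E.
Proof.
rewrite (@ge0_integral_distribution _ _ _ _ _ P to_src (fun s' => psi (s', s)))//.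
exact: (@measurable_fun_pair1 _ _ _ _ (pastT r) _ psi s mpsi).
Qed.

Lemma measurable_decouple :
  measurable_fun setT (fun s : pastT r => (\int[P]_s' psi (s', s))%E).
Proof.
have -> : (fun s : pastT r => (\int[P]_s' psi (s', s))%E) =
    fubini_G (distribution P to_src) psi.
  by apply/funext => s; rewrite /fubini_G innerE.
exact: measurable_fun_fubini_tonelli_G.
Qed.

Lemma decouple : (\int[P]_s psi (s, s) = \int[P]_s \int[P]_s' psi (s', s))%E.
Proof.
transitivity (\int[distribution P diag]_z psi z)%E.
  by rewrite ge0_integral_distribution.
(* Independence enters here: the law of [diag] agrees with the product law on rectangles, hence
   everywhere. *)
transitivity (\int[distribution P to_src \x distribution P to_past]_z psi z)%E.
  apply: eq_measure_integral => A mA _; apply/esym.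
  apply: product_measure_unique => // B C mB mC.
  rewrite /distribution /pushforward.
  rewrite -(indep_past hF hI rj)//; exact/(srcT_measurable hF).
rewrite fubini_tonelli2// ge0_integral_distribution//.
- by apply: eq_integral => s _; exact: innerE.
- exact: measurable_fun_fubini_tonelli_G.
- by move=> s; exact: integral_ge0.
Qed.

End Decoupling.

(** * Convex and smooth functions *)

Section Vectors.
Context (R : realType) (d : nat).
Implicit Types (x y z : vec R d) (a b : R).

Lemma coordD x y j : coord (x + y) j = coord x j + coord y j.
Proof. by rewrite /coord mxE. Qed.

Lemma coordN x j : coord (- x) j = - coord x j.
Proof. by rewrite /coord mxE. Qed.

Lemma coordZ a x j : coord (a *: x) j = a * coord x j.
Proof. by rewrite /coord mxE. Qed.

Lemma coord0 j : coord (0 : vec R d) j = 0.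
Proof. by rewrite /coord mxE. Qed.

Lemma vecP x y : (forall j, coord x j = coord y j) -> x = y.
Proof. by move=> xy; apply/rowP => j; exact: xy. Qed.

Definition coordE := (coordD, coordN, coordZ, coord0).

Lemma sqnorm_ge0 x : 0 <= sqnorm x.
Proof. by apply: sumr_ge0 => j _; rewrite -expr2 sqr_ge0. Qed.

Lemma sqnorm_le0 x : sqnorm x <= 0 -> x = 0.
Proof.
move=> x0; have /eqP : sqnorm x = 0 by apply/eqP; rewrite eq_le x0 sqnorm_ge0.
rewrite psumr_eq0 => [/allP H|j _]; last by rewrite -expr2 sqr_ge0.
apply: vecP => j; rewrite coord0; apply/eqP.
by have := H j (mem_index_enum _); rewrite /= mulf_eq0 orbb.
Qed.

Lemma dotDl x y z : dot (x + y) z = dot x z + dot y z.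
Proof.
rewrite /dot -big_split; apply: eq_bigr => j _ /=; rewrite !coordE; ring.
Qed.

Lemma dotZl a x z : dot (a *: x) z = a * dot x z.
Proof.
rewrite /dot mulr_sumr; apply: eq_bigr => j _ /=; rewrite !coordE; ring.
Qed.

Lemma dotC x z : dot x z = dot z x.
Proof. by apply: eq_bigr => j _; rewrite mulrC. Qed.

Lemma dotNl x z : dot (- x) z = - dot x z.
Proof. by rewrite -scaleN1r dotZl mulN1r. Qed.

Lemma dotDr x y z : dot z (x + y) = dot z x + dot z y.
Proof. by rewrite dotC dotDl !(dotC _ z). Qed.

Lemma dotZr a x z : dot z (a *: x) = a * dot z x.
Proof. by rewrite dotC dotZl dotC. Qed.

Lemma dotNr x z : dot z (- x) = - dot z x.
Proof. by rewrite dotC dotNl dotC. Qed.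

Lemma dot0l z : dot 0 z = 0.
Proof. by rewrite -(scale0r z) dotZl mul0r. Qed.

Definition dotE := (dotDl, dotDr, dotZl, dotZr, dotNl, dotNr).

Lemma dot_suml (I : Type) (s : seq I) (F : I -> vec R d) z :
  dot (\sum_(i <- s) F i) z = \sum_(i <- s) dot (F i) z.
Proof.
elim: s => [|i s IH]; first by rewrite !big_nil dot0l.
by rewrite !big_cons dotDl IH.
Qed.

Lemma sqnorm0 : sqnorm (0 : vec R d) = 0.
Proof. exact: dot0l. Qed.

Lemma sqnormN x : sqnorm (- x) = sqnorm x.
Proof. by rewrite /sqnorm !dotE opprK. Qed.

Lemma sqnormZ a x : sqnorm (a *: x) = a ^+ 2 * sqnorm x.
Proof. by rewrite /sqnorm !dotE mulrA expr2. Qed.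

Lemma sqnormD x y : sqnorm (x + y) = sqnorm x + 2 * dot x y + sqnorm y.
Proof. rewrite /sqnorm !dotE (dotC y x); ring. Qed.

Lemma sqnormBC x y : sqnorm (x - y) = sqnorm (y - x).
Proof. by rewrite -sqnormN opprB. Qed.

Lemma sqnormD_young (s : R) x y : 0 < s ->
  sqnorm (x + y) <= (1 + s) * sqnorm x + (1 + s^-1) * sqnorm y.
Proof.
move=> s0; have := sqnorm_ge0 (s *: x - y).
rewrite /sqnorm !dotE (dotC y x) => H.
rewrite -subr_ge0; set e := (X in 0 <= X).
rewrite (_ : e = s^-1 * (s * (s * dot x x) + s * - dot x y + (- (s * dot x y) - - dot y y))).
  by apply: mulr_ge0; [rewrite invr_ge0 ltW|lra].
by rewrite /e; field; rewrite gt_eqF.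
Qed.

Lemma sqnormD_le2 x y : sqnorm (x + y) <= 2 * sqnorm x + 2 * sqnorm y.
Proof.
by have := sqnormD_young x y ltr01; rewrite invr1.
Qed.

Lemma sqnormB_le2 x y z : sqnorm (x - z) <= 2 * sqnorm (x - y) + 2 * sqnorm (y - z).
Proof. by rewrite -(subrKA y x (- z)); exact: sqnormD_le2. Qed.

Lemma dot_le_lip (K : R) x y : 0 <= K -> sqnorm x <= K ^+ 2 * sqnorm y ->
  dot x y <= K * sqnorm y.
Proof.
rewrite le_eqVlt => /orP[/eqP <-|K0] xy.
  by rewrite expr0n/= !mul0r in xy *; rewrite (sqnorm_le0 xy) dot0l.
have := sqnorm_ge0 (x - K *: y).
rewrite sqnormD sqnormN sqnormZ dotNr dotZr => H.
rewrite -(ler_pM2l K0); nra.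
Qed.

Lemma enorm_sqnorm (K : R) x y : 0 <= K -> enorm x <= K * enorm y ->
  sqnorm x <= K ^+ 2 * sqnorm y.
Proof.
move=> K0 /(lerXn2r 2); rewrite !nnegrE sqrtr_ge0 mulr_ge0 ?sqrtr_ge0// => /(_ isT isT).
by rewrite exprMn !sqr_sqrtr// sqnorm_ge0.
Qed.

End Vectors.

(** * Quadratic bounds, Bregman divergence and cocoercivity *)

Section Smooth.
Context (R : realType) (d : nat).
Implicit Types (L mu : R) (f : vec R d -> R) (g : vec R d -> vec R d) (x y v : vec R d).

Definition bregman f g x y : R := f x - f y - dot (g y) (x - y).

(** [is_gradient] differentiates at parameter 0 only; moving the base point to y + s v and composing
    with the shift t - s reaches every point of the line. *)
Lemma is_derive_line f g y v (s : R) : is_gradient f g ->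
  is_derive s (1 : R) (fun t : R => f (y + t *: v)) (dot (g (y + s *: v)) v).
Proof.
move=> fg; have D := fg (y + s *: v) v.
have D1 : is_derive s (1 : R) (fun t : R => t - s) (1 : R).
  rewrite -[X in is_derive _ _ _ X](subr0 (1 : R)).
  exact: is_deriveB.
have D' : is_derive ((fun t : R => t - s) s) (1 : R)
    (fun t : R => f (y + s *: v + t *: v)) (dot (g (y + s *: v)) v).
  by rewrite subrr.
have := @is_derive1_comp _ _ (fun t : R => t - s) s _ _ D' D1.
rewrite mulr1; congr is_derive; apply/funext => t /=.
by rewrite -addrA -scalerDl subrKC.
Qed.

Lemma gradient_opp f g : is_gradient f g ->
  is_gradient (fun x => - f x) (fun x => - g x).
Proof. by move=> fg x v; rewrite dotNl; have D := fg x v; exact: is_deriveN. Qed.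

Lemma smooth_opp L f g : smooth_with L f g ->
  smooth_with L (fun x => - f x) (fun x => - g x).
Proof.
move=> [fg Lg]; split; first exact: gradient_opp.
by move=> x y; rewrite -opprD /enorm sqnormN; exact: Lg.
Qed.

Lemma smooth_lip L f g x y : 0 <= L -> smooth_with L f g ->
  sqnorm (g x - g y) <= L ^+ 2 * sqnorm (x - y).
Proof. by move=> L0 [_ Lg]; exact: enorm_sqnorm. Qed.

(** [phi] is f along the segment minus its quadratic upper model. Its derivative is nonpositive on
    the segment by the Lipschitz bound on [g], so phi 1 is at most phi 0. *)
Lemma smooth_descent L f g y v : 0 <= L -> smooth_with L f g ->
  f (y + v) <= f y + dot (g y) v + L / 2 * sqnorm v.
Proof.
move=> L0 Lf; have [fg _] := Lf.
pose phi := fun t : R => f (y + t *: v) - (t * dot (g y) v + L / 2 * sqnorm v * t ^+ 2).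
have dphi (t : R) : is_derive t (1 : R) phi
    (dot (g (y + t *: v)) v - (dot (g y) v + L * sqnorm v * t)).
  have D1 := is_derive_line y v t fg.
  have D2 : is_derive t (1 : R)
      ((fun t : R => t * dot (g y) v) + (fun t => L / 2 * sqnorm v * t ^+ 2))
      (dot (g y) v + L * sqnorm v * t).
    by apply: is_derive_eq; rewrite /GRing.scale/=; field.
  exact: (@is_deriveB _ _ _ _ _ _ _ _ _ D1 D2).
have dph (t : R) : derivable phi t 1 by case: (dphi t).
have dph0 (t : R) : t \in `]0, 1[%R -> derive1 phi t <= 0.
  rewrite in_itv/= => /andP[t0 _].
  rewrite derive1E (@derive_val _ _ _ _ _ _ _ (dphi t)) subr_le0 -lerBlDl.
  rewrite -dotNl -dotDl.
  rewrite (_ : L * sqnorm v * t = L * t * sqnorm v); last by ring.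
  apply: dot_le_lip; first by rewrite mulr_ge0// ltW.
  apply: le_trans (smooth_lip _ _ L0 Lf) _.
  by rewrite addrAC subrr add0r sqnormZ exprMn mulrA.
have cph : {within `[0, 1], continuous phi}.
  by apply: derivable_within_continuous => t _.
have := @ler0_derive1_le_cc _ phi 0 1 (fun t _ => dph t) dph0 cph 1 0.
rewrite !in_itv/= !lexx ler01 => /(_ isT isT isT).
rewrite /phi scale1r scale0r addr0 mul0r expr0n/= mulr0 addr0 subr0 mul1r expr1n mulr1; lra.
Qed.

Lemma smooth_ascent L f g y v : 0 <= L -> smooth_with L f g ->
  f y + dot (g y) v - L / 2 * sqnorm v <= f (y + v).
Proof.
move=> L0 /smooth_opp Lf; have := smooth_descent y v L0 Lf.
rewrite dotNl; lra.
Qed.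

(** Strong convexity at y + l v is compared with the lower quadratic model at the same point and
    divided by l. This leaves an error l c, where c does not depend on l, and l is then taken as
    small as needed. *)
Lemma strongly_convex_gradient L mu f g x y : 0 <= L -> smooth_with L f g ->
  strongly_convex mu f -> mu / 2 * sqnorm (x - y) <= bregman f g x y.
Proof.
move=> L0 Lf cf; rewrite /bregman; set v := x - y; set S := sqnorm v.
have S0 : 0 <= S by exact: sqnorm_ge0.
have key (l : R) : 0 < l <= 1 ->
    dot (g y) v + mu / 2 * S <= f x - f y + l * ((L / 2 + mu / 2) * S).
  move=> /andP[l0 l1].
  have := cf x y l; rewrite l1 ltW//= => /(_ isT).
  have -> : l *: x + (1 - l) *: y = y + l *: v.
    by rewrite /v scalerBl scale1r scalerBr addrCA.
  have := smooth_ascent y (l *: v) L0 Lf; rewrite dotZr sqnormZ -/v -/S => H1 H2.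
  rewrite -(ler_pM2l l0); nra.
set c := (L / 2 + mu / 2) * S in key.
suff : dot (g y) v + mu / 2 * S <= f x - f y by lra.
have [c0|c0] := leP c 0.
  by have := key 1; rewrite ltr01 lexx => /(_ isT); lra.
apply/ler_addgt0Pr => e e0.
have m0 : 0 < Num.min 1 (e / c) by rewrite lt_min ltr01 divr_gt0.
have := key (Num.min 1 (e / c)); rewrite m0 ge_min lexx => /(_ isT) H.
apply: le_trans H _; rewrite lerD2l -ler_pdivlMr//.
by rewrite ge_min lexx orbT.
Qed.

Lemma convex_gradient L f g x y : 0 <= L -> smooth_with L f g ->
  convex_fun f -> 0 <= bregman f g x y.
Proof.
move=> L0 Lf cf; have := @strongly_convex_gradient L 0 f g x y L0 Lf.
rewrite mul0r mul0r; apply => a b l /(cf a b l) H.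
by rewrite !mul0r subr0.
Qed.

Lemma bregman_smooth L f g x y : 0 <= L -> smooth_with L f g ->
  bregman f g x y <= L / 2 * sqnorm (x - y).
Proof.
move=> L0 Lf; have := smooth_descent y (x - y) L0 Lf.
rewrite subrKC /bregman; lra.
Qed.

(** One gradient step v = - (g x - g y) / L from [x]: the value at x + v is bounded above by descent
    from [x] and below by convexity at [y]. For L = 0 the map [g] is constant. *)
Lemma cocoercive L f g x y : 0 <= L -> smooth_with L f g -> convex_fun f ->
  sqnorm (g x - g y) <= 2 * L * bregman f g x y.
Proof.
move=> L0 Lf cf; move: (L0); rewrite le_eqVlt => /orP[/eqP L00|Lp].
  have := smooth_lip x y L0 Lf; rewrite -L00; lra.
set w := g x - g y.
pose v := - L^-1 *: w.
have h1 := smooth_descent x v L0 Lf.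
have h2 := convex_gradient (x + v) y L0 Lf cf.
have e1 : sqnorm w = dot (g x) w - dot (g y) w.
  by rewrite {1}/w /sqnorm dotDl dotNl.
have e2 : L / 2 * sqnorm v = L^-1 / 2 * sqnorm w.
  by rewrite /v sqnormZ; field; rewrite gt_eqF.
have e3 z : dot z v = - L^-1 * dot z w by rewrite /v dotZr.
rewrite e2 e3 in h1; rewrite /bregman (addrAC x v) dotDr e3 in h2.
have h3 : L^-1 / 2 * sqnorm w <= bregman f g x y.
  by rewrite /bregman; move: h1 h2; rewrite e1; lra.
have -> : sqnorm w = 2 * L * (L^-1 / 2 * sqnorm w).
  by field; rewrite gt_eqF.
by rewrite ler_wpM2l// mulr_ge0.
Qed.

End Smooth.

Section Average.
Context (R : realType) (n d : nat).
Variables (f : 'I_n -> vec R d -> R) (gf : 'I_n -> vec R d -> vec R d) (Li : 'I_n -> R).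
Hypothesis Lf : forall i, 0 <= Li i /\ smooth_with (Li i) (f i) (gf i).
Hypothesis cf : forall i, convex_fun (f i).

Lemma Lmax_ge i : Li i <= Lmax_of Li.
Proof. exact: le_bigmax. Qed.

Lemma Lmax_ge0 : 0 <= Lmax_of Li.
Proof. exact: bigmax_ge_id. Qed.

Lemma bregman_avg x y :
  bregman (favg f) (gavg gf) x y = n%:R^-1 * \sum_i bregman (f i) (gf i) x y.
Proof.
rewrite /bregman /favg /gavg dotZl dot_suml !sumrB; ring.
Qed.

(** Cocoercivity of each [f i]; the individual Bregman divergences are nonnegative and average to
    that of the mean, so a single factor Lmax appears. *)
Lemma grad_diff_avg x y :
  n%:R^-1 * \sum_i sqnorm (gf i x - gf i y)
    <= 2 * Lmax_of Li * bregman (favg f) (gavg gf) x y.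
Proof.
rewrite bregman_avg mulrCA ler_wpM2l ?invr_ge0// mulr_sumr ler_sum// => i _.
have [L0 S] := Lf i.
apply: le_trans (cocoercive x y L0 S (cf i)) _.
rewrite ler_wpM2r// ?ler_wpM2l ?Lmax_ge//.
exact: convex_gradient L0 S (cf i).
Qed.

Lemma convex_avg : convex_fun (favg f).
Proof.
move=> x y l l01; rewrite /favg mulrCA [X in _ <= _ + X]mulrCA -mulrDr.
rewrite ler_wpM2l ?invr_ge0// !mulr_sumr -big_split ler_sum// => i _.
exact: cf.
Qed.

End Average.

(** * Square-integrable random vectors *)

Section MeasurableVectors.
Context (R : realType) (d : nat).

(** Continuity for the Euclidean distance, stated on [sqnorm] so that no topology on [vec]
    intervenes. *)
Definition econtinuous (phi : vec R d -> R) := forall x (e : R), 0 < e ->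
  exists2 dl : R, 0 < dl & forall y, sqnorm (y - x) < dl -> `|phi y - phi x| < e.

Lemma measurable_coord (j : 'I_d) :
  measurable_fun setT (fun x : vecm R d => coord x j).
Proof.
move=> _ B mB; rewrite setTI; apply: sub_sigma_algebra.
by exists j, B.
Qed.

Lemma measurable_box (q : 'I_d -> R) (r : R) :
  measurable ([set x : vecm R d | forall j, `|coord x j - q j| < r]).
Proof.
have -> : [set x : vecm R d | forall j, `|coord x j - q j| < r] =
    \bigcap_(j in [set: 'I_d]) [set x : vecm R d | `|coord x j - q j| < r].
  by apply/seteqP; split => x H j; [move=> _|]; exact: H.
apply: fin_bigcap_measurable => // j _.
rewrite (_ : mkset _ = (fun x : vecm R d => coord x j) @^-1` `]q j - r, q j + r[).
  by rewrite -[X in measurable X]setTI; apply: measurable_coord.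
apply/seteqP; split => x /=; rewrite in_itv/= ltr_distl; first by [].
by [].
Qed.

Lemma measurable_econtinuous (phi : vec R d -> R) : econtinuous phi ->
  measurable_fun setT (phi : vecm R d -> R).
Proof.
(* The sigma-algebra of [vecm] only knows half-spaces: write an open set as the countable union
   of the rational boxes it contains. *)
move=> cphi; apply: (measurability _ (RGenOInfty.measurableE R)) => //.
move=> /= _ [_ [a ->] <-]; rewrite setTI preimage_itvoy.
pose box (qr : {ffun 'I_d -> rat} * rat) := [set x : vecm R d |
  forall j, `|coord x j - ratr (qr.1 j)| < ratr qr.2].
pose U := [set x : vecm R d | a < phi x].
rewrite -/U.
have -> : U = \bigcup_qr (if `[< box qr `<=` U >] then box qr else set0).
  apply/seteqP; split => x; last first.
    by move=> [qr _]; case: asboolP => // H; exact: H.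
  move=> Ux; have e0 : 0 < phi x - a by rewrite subr_gt0.
  have [dl dl0 H] := cphi x _ e0.
  (* A point of the box differs from [x] by less than 2r in each coordinate, so its squared distance
     is at most 4 d r^2, and r below 1 gives r^2 below r. The added 1 keeps [c] positive for d =
     0. *)
  pose c : R := d%:R * 4 + 1.
  have c0 : 0 < c by rewrite /c ltr_wpDl// mulr_ge0.
  pose r0 := Num.min 1 (dl / c).
  have r00 : 0 < r0 by rewrite lt_min ltr01 divr_gt0.
  have [r r0r] := rat_in_itvoo r00.
  have [rpos rr0] : 0 < (ratr r : R) /\ ratr r < r0.
    by move: r0r => /itvP h; rewrite !h.
  have /fin_all_exists[q Hq] : forall j : 'I_d, exists q : rat, `|coord x j - ratr q| < ratr r.
    move=> j; have lt : coord x j - ratr r < coord x j + ratr r by lra.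
    have [q /itvP qj] := rat_in_itvoo lt.
    by exists q; rewrite distrC ltr_distl !qj.
  exists ([ffun j => q j], r) => //; case: asboolP => [_|]; first by move=> j /=; rewrite ffunE.
  case=> y /= Hy; rewrite /U/=.
  have : sqnorm ((y : vec R d) - x) < dl.
    have dl1 : (ratr r : R) ^+ 2 * c < dl.
      rewrite -ltr_pdivlMr//; apply: le_lt_trans (_ : ratr r < _).
        rewrite expr2 ler_piMr//; first exact: ltW.
        by apply/ltW/(lt_le_trans rr0); rewrite ge_min lexx.
      by apply: (lt_le_trans rr0); rewrite ge_min lexx orbT.
    apply: le_lt_trans dl1; apply: le_trans (_ : \sum_(j < d) (4 * ratr r ^+ 2) <= _).
      apply: ler_sum => j _; rewrite coordD coordN.
      have := Hy j; rewrite ffunE => h1; have h2 := Hq j.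
      have : `|coord y j - coord x j| < 2 * ratr r.
        apply: le_lt_trans (ler_distD (ratr (q j)) _ _) _.
        rewrite (distrC (ratr _)); lra.
      move=> h3; rewrite -expr2 -real_normK ?num_real//.
      have := normr_ge0 (coord y j - coord x j); nra.
    rewrite sumr_const card_ord -mulr_natr /c; nra.
  move=> /H; rewrite ltr_norml => /andP[h _]; lra.
apply: countable_bigcupT_measurable => // qr.
by case: ifP => // _; exact: measurable_box.
Qed.

End MeasurableVectors.

Section EContinuous.
Context (R : realType) (d : nat).

Lemma econtinuous_lip (g : vec R d -> vec R d) (K : R) (j : 'I_d) : 0 <= K ->
  (forall x y, sqnorm (g x - g y) <= K * sqnorm (x - y)) ->
  econtinuous (fun x => coord (g x) j).
Proof.
move=> K0 gK x e e0; exists (e ^+ 2 / (K + 1)).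
  by rewrite divr_gt0// ?exprn_gt0// ltr_wpDl.
move=> y; rewrite ltr_pdivlMr ?ltr_wpDl// => H.
rewrite -(@ltr_pXn2r _ 2)// ?nnegrE ?ltW// real_normK ?num_real//.
apply: le_lt_trans H; apply: le_trans (_ : sqnorm (g y - g x) <= _).
  rewrite /sqnorm /dot (bigD1 j)//= coordD coordN -expr2 lerDl.
  by apply: sumr_ge0 => i _; rewrite -expr2 sqr_ge0.
by apply: le_trans (gK _ _) _; have := sqnorm_ge0 (y - x); nra.
Qed.

(** The linear term is split by Young's inequality with weight [c]: the increment is at most (c S +
    (1/c + L) V) / 2, where V is the squared distance. The choice of [c] makes c S smaller than e,
    and the radius does the same for the other term. *)
Lemma econtinuous_smooth L (f : vec R d -> R) g : 0 <= L -> smooth_with L f g ->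
  econtinuous f.
Proof.
move=> L0 Lf x e e0.
set S := sqnorm (g x).
have S0 : 0 <= S := sqnorm_ge0 _.
pose c := e / (S + 1).
have c0 : 0 < c by rewrite divr_gt0// ltr_wpDl.
have cS : c * S < e.
  by rewrite /c mulrAC ltr_pdivrMr ?ltr_wpDl// ltr_pM2l// ltrDl.
have k0 : 0 < c^-1 + L by rewrite ltr_wpDr// invr_gt0.
exists (e / (c^-1 + L)); first by rewrite divr_gt0.
move=> y; rewrite ltr_pdivlMr// => H.
move: H; have := smooth_ascent x (y - x) L0 Lf; have := smooth_descent x (y - x) L0 Lf.
rewrite subrKC; move: (y - x) => v.
have := sqnorm_ge0 (c *: g x - v); have := sqnorm_ge0 (c *: g x + v).
rewrite !sqnormD sqnormN dotNr dotZl sqnormZ -/S.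
have := sqnorm_ge0 v; move: (sqnorm v) (dot _ _) => V D V0 k1 k2 h1 h2 H.
have e1 : c^-1 * (c ^+ 2 * S + 2 * (c * D) + V) = c * S + 2 * D + c^-1 * V.
  by field; rewrite gt_eqF.
have e2 : c^-1 * (c ^+ 2 * S + 2 * - (c * D) + V) = c * S - 2 * D + c^-1 * V.
  by field; rewrite gt_eqF.
have ci0 : 0 <= c^-1 by rewrite invr_ge0 ltW.
have := mulr_ge0 ci0 k1; have := mulr_ge0 ci0 k2; rewrite e1 e2 => {}k2 {}k1.
by rewrite ltr_norml; apply/andP; split; lra.
Qed.

End EContinuous.

Section MeasVec.
Context (R : realType) (d : nat) (dS : measure_display) (S : measurableType dS).
Implicit Types (X Y : S -> vec R d).

Definition vmeas X := measurable_fun setT (X : S -> vecm R d).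

Lemma vmeasP X : vmeas X <-> forall j, measurable_fun setT (fun s => coord (X s) j).
Proof.
split=> [mX j|H].
  exact: (measurableT_comp (measurable_coord j) mX).
apply: (@measurability _ _ S (vecm R d) setT X (@coord_sets R d) erefl).
move=> _ [_ [j [B [mB ->]]] <-].
rewrite setTI -comp_preimage -[X in measurable X]setTI.
exact: H.
Qed.

Lemma vmeas_comp X (phi : vec R d -> R) : vmeas X -> econtinuous phi ->
  measurable_fun setT (fun s => phi (X s)).
Proof. by move=> mX /measurable_econtinuous mphi; exact: (measurableT_comp mphi mX). Qed.

Lemma vmeas_lip X (g : vec R d -> vec R d) K : 0 <= K ->
  (forall x y, sqnorm (g x - g y) <= K * sqnorm (x - y)) ->
  vmeas X -> vmeas (fun s => g (X s)).
Proof.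
move=> K0 gK mX; apply/vmeasP => j.
exact: vmeas_comp mX (econtinuous_lip j K0 gK).
Qed.

Lemma vmeas_cst x : vmeas (fun=> x).
Proof. exact: measurable_cst. Qed.

Lemma vmeasD X Y : vmeas X -> vmeas Y -> vmeas (fun s => X s + Y s).
Proof.
move=> /vmeasP mX /vmeasP mY; apply/vmeasP => j.
by under eq_fun do rewrite coordD; exact: measurable_funD.
Qed.

Lemma vmeasZ a X : vmeas X -> vmeas (fun s => a *: X s).
Proof.
move=> /vmeasP mX; apply/vmeasP => j.
by under eq_fun do rewrite coordZ; exact: measurable_funM.
Qed.

Lemma vmeasB X Y : vmeas X -> vmeas Y -> vmeas (fun s => X s - Y s).
Proof.
move=> mX mY; under eq_fun do rewrite -scaleN1r.
by apply: vmeasD => //; exact: vmeasZ.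
Qed.

Lemma measurable_dot X Y : vmeas X -> vmeas Y ->
  measurable_fun setT (fun s => dot (X s) (Y s)).
Proof.
move=> /vmeasP mX /vmeasP mY; apply: measurable_sum => j.
exact: measurable_funM.
Qed.

End MeasVec.

(** * Integrable and square-integrable variables known at a given stage *)

Section Spaces.
Context (R : realType) (dT : measure_display) (T : measurableType dT).
Context (P : probability T R) (J : Type) (F : J -> set (set T)).
Context (rank : J -> nat).
Hypothesis hF : forall j, sub_sigma (F j).
Local Notation pastT r := (g_sigma_algebraType (past F rank r)).
Local Notation srcT j := (g_sigma_algebraType (F j)).

(** The rank [r] records when the variable is known: it is measurable for the sources of rank below
    [r], while integrability refers to [P] on all of [T]. *)
Definition L1 r (X : T -> R) :=
  measurable_fun setT (X : pastT r -> R) /\ P.-integrable setT (EFin \o X).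

Definition ER (X : T -> R) : R := \int[P]_s X s.

Lemma past_measurable r dU (U : measurableType dU) (X : T -> U) :
  measurable_fun setT (X : pastT r -> U) -> measurable_fun setT X.
Proof.
move=> mX _ B mB; have := mX measurableT B mB.
by move=> /(pastT_sub hF).
Qed.

Lemma past_mono r r' dU (U : measurableType dU) (X : T -> U) : (r <= r')%N ->
  measurable_fun setT (X : pastT r -> U) -> measurable_fun setT (X : pastT r' -> U).
Proof.
move=> rr' mX _ B mB; have := mX measurableT B mB.
exact: (pastT_le rr').
Qed.

Lemma L1_meas r X : L1 r X -> measurable_fun setT X.
Proof. by move=> [+ _]; exact: past_measurable. Qed.

Lemma L1_mono r r' X : (r <= r')%N -> L1 r X -> L1 r' X.
Proof. by move=> rr' [mX iX]; split => //; exact: past_mono mX. Qed.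

Lemma L1_dom r r' X Y : measurable_fun setT (X : pastT r -> R) -> L1 r' Y ->
  (forall s, `|X s| <= Y s) -> L1 r X.
Proof.
move=> mX [_ iY] XY; split => //.
apply: le_integrable iY => //.
  by apply/measurable_EFinP; exact: past_measurable mX.
by move=> s _ /=; rewrite lee_fin (le_trans (XY s))// ler_norm.
Qed.

Lemma L1_cst r a : L1 r (fun=> a).
Proof. by split; [exact: measurable_cst|exact: finite_measure_integrable_cst]. Qed.

Lemma L1D r X Y : L1 r X -> L1 r Y -> L1 r (fun s => X s + Y s).
Proof.
move=> [mX iX] [mY iY]; split; first exact: measurable_funD.
rewrite (_ : _ \o _ = (EFin \o X) \+ (EFin \o Y))%E; first exact: integrableD.
by apply/funext => s /=; rewrite EFinD.
Qed.

Lemma L1Z r a X : L1 r X -> L1 r (fun s => a * X s).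
Proof.
move=> [mX iX]; split; first exact: measurable_funM.
rewrite (_ : _ \o _ = fun s => a%:E * (EFin \o X) s)%E; first exact: integrableZl.
by apply/funext => s /=; rewrite EFinM.
Qed.

Lemma L1B r X Y : L1 r X -> L1 r Y -> L1 r (fun s => X s - Y s).
Proof.
move=> LX LY; under eq_fun do rewrite -mulN1r.
by apply: L1D => //; exact: L1Z.
Qed.

Lemma L1_sum r (I : Type) (l : seq I) (X : I -> T -> R) :
  (forall i, L1 r (X i)) -> L1 r (fun s => \sum_(i <- l) X i s).
Proof.
move=> LX; elim: l => [|i l IH].
  by under eq_fun do rewrite big_nil; exact: L1_cst.
by under eq_fun do rewrite big_cons; exact: L1D.
Qed.

Lemma ER_cst a : ER (fun=> a) = a.
Proof.
rewrite /ER Rintegral_cst//.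
by rewrite [X in fine X](_ : _ = 1%E) ?mulr1//; exact: probability_setT.
Qed.

Lemma ERD r r' X Y : L1 r X -> L1 r' Y -> ER (fun s => X s + Y s) = ER X + ER Y.
Proof. by move=> [_ iX] [_ iY]; exact: RintegralD. Qed.

Lemma ERZ r a X : L1 r X -> ER (fun s => a * X s) = a * ER X.
Proof. by move=> [_ iX]; exact: RintegralZl. Qed.

Lemma ER_sum r (I : Type) (l : seq I) (X : I -> T -> R) :
  (forall i, L1 r (X i)) -> ER (fun s => \sum_(i <- l) X i s) = \sum_(i <- l) ER (X i).
Proof.
move=> LX; elim: l => [|i l IH].
  by under eq_fun do rewrite big_nil; rewrite ER_cst big_nil.
under eq_fun do rewrite big_cons.
by rewrite (ERD (LX i) (L1_sum _ LX)) IH big_cons.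
Qed.

Lemma ER_ge0 X : (forall s, 0 <= X s) -> 0 <= ER X.
Proof. by move=> X0; exact: Rintegral_ge0. Qed.

Lemma ExpectE r X : L1 r X -> Expect P X = (ER X)%:E.
Proof. by move=> [_ iX]; rewrite /ER /Rintegral fineK//; exact: integrable_fin_num. Qed.

Section Square.
Variable d : nat.
Implicit Types (X Y : T -> vec R d).

Definition L2 r X := vmeas (X : pastT r -> vec R d) /\
  P.-integrable setT (fun s => (sqnorm (X s))%:E).

Lemma L2_sq r X : L2 r X -> L1 r (fun s => sqnorm (X s)).
Proof. by move=> [mX iX]; split => //; exact: measurable_dot. Qed.

Lemma L2_mono r r' X : (r <= r')%N -> L2 r X -> L2 r' X.
Proof. by move=> rr' [mX iX]; split => //; exact: past_mono mX. Qed.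

Lemma L2_dom r r' X Z : vmeas (X : pastT r -> vec R d) -> L1 r' Z ->
  (forall s, sqnorm (X s) <= Z s) -> L2 r X.
Proof.
move=> mX LZ XZ; split => //.
have [] // := @L1_dom r r' (fun s => sqnorm (X s)) Z _ LZ _.
  exact: measurable_dot.
by move=> s; rewrite ger0_norm ?sqnorm_ge0.
Qed.

Lemma L2_cst r x : L2 r (fun=> x).
Proof. by apply: (@L2_dom _ r _ (fun=> sqnorm x)) => //; [exact: vmeas_cst|exact: L1_cst]. Qed.

Lemma L2D r X Y : L2 r X -> L2 r Y -> L2 r (fun s => X s + Y s).
Proof.
move=> LX LY; apply: (@L2_dom _ r _ (fun s => 2 * sqnorm (X s) + 2 * sqnorm (Y s))).
- exact: vmeasD LX.1 LY.1.
- by apply: L1D; apply: L1Z; exact: L2_sq.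
- by move=> s; exact: sqnormD_le2.
Qed.

Lemma L2Z r a X : L2 r X -> L2 r (fun s => a *: X s).
Proof.
move=> LX; apply: (@L2_dom _ r _ (fun s => a ^+ 2 * sqnorm (X s))).
- exact: vmeasZ LX.1.
- by apply: L1Z; exact: L2_sq.
- by move=> s; rewrite sqnormZ.
Qed.

Lemma L2B r X Y : L2 r X -> L2 r Y -> L2 r (fun s => X s - Y s).
Proof.
move=> LX LY; under eq_fun do rewrite -scaleN1r.
by apply: L2D => //; exact: L2Z.
Qed.

Lemma L2_sum r (I : Type) (l : seq I) (X : I -> T -> vec R d) :
  (forall i, L2 r (X i)) -> L2 r (fun s => \sum_(i <- l) X i s).
Proof.
move=> LX; elim: l => [|i l IH].
  by under eq_fun do rewrite big_nil; exact: L2_cst.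
by under eq_fun do rewrite big_cons; exact: L2D.
Qed.

Lemma L2_lip r X (g : vec R d -> vec R d) K : 0 <= K ->
  (forall x y, sqnorm (g x - g y) <= K * sqnorm (x - y)) ->
  L2 r X -> L2 r (fun s => g (X s)).
Proof.
move=> K0 gK LX.
apply: (@L2_dom _ r _ (fun s => 2 * K * sqnorm (X s) + 2 * sqnorm (g 0))).
- exact: vmeas_lip K0 gK LX.1.
- by apply: L1D; [apply: L1Z; exact: L2_sq|exact: L1_cst].
- move=> s; rewrite -[in leLHS](subrK (g 0) (g (X s))).
  apply: le_trans (sqnormD_le2 _ _) _; rewrite lerD2r -mulrA ler_pM2l//.
  by apply: le_trans (gK _ _) _; rewrite subr0.
Qed.

Lemma L1_dot r X Y : L2 r X -> L2 r Y -> L1 r (fun s => dot (X s) (Y s)).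
Proof.
move=> LX LY; apply: (@L1_dom _ r _ (fun s => sqnorm (X s) + sqnorm (Y s))).
- exact: measurable_dot LX.1 LY.1.
- by apply: L1D; exact: L2_sq.
- move=> s; have := sqnorm_ge0 (X s + Y s); have := sqnorm_ge0 (X s - Y s).
  have := sqnorm_ge0 (X s); have := sqnorm_ge0 (Y s).
  rewrite !sqnormD sqnormN dotNr ler_norml; lra.
Qed.

(** A smooth function grows at most quadratically, so it is integrable along a square-integrable
    vector. *)
Lemma L1_smooth r X L f g : 0 <= L -> smooth_with L f g -> L2 r X ->
  L1 r (fun s => f (X s)).
Proof.
move=> L0 Lf LX.
apply: (@L1_dom _ r _ (fun s => `|f 0| + (1 / 2 * sqnorm (g 0) + (1 / 2 + L / 2) * sqnorm (X s)))).
- exact: vmeas_comp LX.1 (econtinuous_smooth L0 Lf).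
- by apply: L1D; [exact: L1_cst|apply: L1D; [exact: L1_cst|apply: L1Z; exact: L2_sq]].
- move=> s; have := smooth_ascent 0 (X s) L0 Lf; have := smooth_descent 0 (X s) L0 Lf.
  rewrite add0r => h1 h2.
  have := sqnorm_ge0 (g 0 + X s); have := sqnorm_ge0 (g 0 - X s).
  rewrite !sqnormD sqnormN dotNr ler_norml => h3 h4.
  have := ler_norm (f 0); have := ler_norm (- f 0); rewrite normrN => h5 h6.
  by apply/andP; split; nra.
Qed.

End Square.
End Spaces.

(** * Compressors and coins *)

Section Compressors.
Context (R : realType) (dT : measure_display) (T : measurableType dT).
Context (P : probability T R) (J : Type) (F : J -> set (set T)).
Context (rank : J -> nat).
Hypothesis hF : forall j, sub_sigma (F j).
Hypothesis hI : mutually_independent P F.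
Local Notation pastT r := (g_sigma_algebraType (past F rank r)).
Local Notation srcT j := (g_sigma_algebraType (F j)).
Local Notation L1 := (L1 P F rank).
Local Notation L2 := (L2 P F rank).
Local Notation ER := (ER P).

Lemma L1_norm r (X : T -> R) : L1 r X -> L1 r (fun s => `|X s|).
Proof.
move=> [mX iX]; have mX' : measurable_fun setT ((fun s => `|X s|) : pastT r -> R).
  exact: measurableT_comp.
split => //; apply: le_integrable iX => //.
  by apply/measurable_EFinP; exact: (past_measurable hF mX').
by move=> s _ /=; rewrite lee_fin normr_id.
Qed.

(** The compressor classes only bound an extended integral; a finite bound on a nonnegative variable
    yields both integrability and the real inequality. *)
Lemma L1_finite r (X : T -> R) (a : R) :
  measurable_fun setT (X : pastT r -> R) -> (forall s, 0 <= X s) ->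
  (\int[P]_s (X s)%:E <= a%:E)%E -> L1 r X /\ ER X <= a.
Proof.
move=> mX X0 Xa.
have LX : L1 r X.
  split => //; apply/integrableP; split.
    by apply/measurable_EFinP; exact: (past_measurable hF mX).
  under eq_integral do rewrite gee0_abs ?lee_fin//=.
  exact: le_lt_trans Xa (ltry _).
by split => //; have := ExpectE LX; rewrite /Expect => E; rewrite E lee_fin in Xa.
Qed.

(** Takes the place of a conditional expectation: a bound [phi] on the integral over the fresh
    source, valid for each frozen past, is integrated over the past. *)
Lemma decouple_le j r (psi : T -> T -> R) (phi : T -> R) : (r <= rank j)%N ->
  measurable_fun setT (fun z : (srcT j * pastT r)%type => psi z.1 z.2) ->
  (forall s' s, 0 <= psi s' s) -> L1 r phi ->
  (forall s, (\int[P]_s' (psi s' s)%:E <= (phi s)%:E)%E) ->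
  (\int[P]_s (psi s s)%:E <= (ER phi)%:E)%E.
Proof.
move=> rj mpsi psi0 Lphi H.
have := @decouple _ _ _ P _ F rank hF hI j r rj (fun z => (psi z.1 z.2)%:E).
rewrite /= => ->; first last.
- by move=> x; rewrite lee_fin.
- exact/measurable_EFinP.
have in0 s : (0 <= \int[P]_s' (psi s' s)%:E)%E.
  by apply: integral_ge0 => s' _; rewrite lee_fin.
have mpsi' : measurable_fun setT (fun z : (srcT j * pastT r)%type => (psi z.1 z.2)%:E).
  exact/measurable_EFinP.
have psi0' (z : (srcT j * pastT r)%type) : (0 <= (psi z.1 z.2)%:E)%E by rewrite lee_fin.
have min := measurable_decouple P hF mpsi' psi0'.
rewrite -(ExpectE Lphi) /Expect; apply: ge0_le_integral => //.
- exact: (past_measurable hF min).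
- by apply/measurable_EFinP; exact: (L1_meas hF Lphi).
Qed.

Section Coin.
Variables (j : J) (c : T -> bool) (p : R).
Hypothesis Fc : F j [set s | c s].
Hypothesis Pc : P [set s | c s] = p%:E.

Lemma coin_measurable : measurable_fun setT (c : srcT j -> bool).
Proof.
apply: (@measurable_fun_bool _ _ _ _ true); rewrite setTI.
by apply/(srcT_measurable hF); rewrite (_ : _ @^-1` _ = [set s | c s]).
Qed.

Lemma coin_past_measurable r : (rank j < r)%N -> measurable_fun setT (c : pastT r -> bool).
Proof.
move=> jr _ B mB; have := coin_measurable measurableT mB.
exact: (srcT_past hF).
Qed.

Lemma L1_coin r r' (X Y : T -> R) : (rank j < r')%N -> (r <= r')%N ->
  L1 r X -> L1 r Y -> L1 r' (fun s => if c s then X s else Y s).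
Proof.
move=> jr rr LX LY.
have := L1_mono rr LX; have := L1_mono rr LY => LY' LX'.
have [mX iX] := LX'; have [mY iY] := LY'.
apply: (@L1_dom _ _ _ _ _ _ _ hF _ r' _ (fun s => `|X s| + `|Y s|)).
- apply: measurable_fun_ifT => //; exact: coin_past_measurable.
- by apply: L1D; exact: L1_norm.
- by move=> s; case: ifP => _; rewrite ?lerDl ?lerDr.
Qed.

Lemma L2_coin d r r' (X Y : T -> vec R d) : (rank j < r')%N -> (r <= r')%N ->
  L2 r X -> L2 r Y -> L2 r' (fun s => if c s then X s else Y s).
Proof.
move=> jr rr LX LY.
have := L2_mono rr LX; have := L2_mono rr LY => LY' LX'.
apply: (@L2_dom _ _ _ _ _ _ _ hF _ _ r' _ (fun s => sqnorm (X s) + sqnorm (Y s))).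
- by apply: measurable_fun_ifT; [exact: coin_past_measurable|exact: LX'.1|exact: LY'.1].
- by apply: L1D => //; exact: L2_sq.
- by move=> s; have := sqnorm_ge0 (X s); have := sqnorm_ge0 (Y s); case: ifP => _; lra.
Qed.

Lemma coin_fixed (a b : R) : (\int[P]_s (if c s then a else b)%:E = (p * a + (1 - p) * b)%:E)%E.
Proof.
have mc : measurable [set s | c s] by exact: (hF j).2.
have cE s : (if c s then a else b) = (a - b) * \1_[set s | c s] s + b.
  rewrite indicE (_ : (s \in [set s | c s]) = c s); last first.
    by apply/idP/idP => [/set_mem//|cs]; exact: mem_set.
  by case: (c s); rewrite ?mulr1 ?mulr0 ?subrK ?add0r.
under eq_integral do rewrite cE.
pose I : T -> R := \1_[set s | c s].
have mI : measurable_fun setT I by exact: measurable_indic.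
have LI : P.-integrable setT (EFin \o I).
  apply: (@le_integrable _ _ _ P _ measurableT _ (cst 1%:E)).
  - exact/measurable_EFinP.
  - move=> s _ /=; rewrite lee_fin /I indicE normr1; case: (_ \in _); rewrite ?normr1 ?normr0//.
  - exact: (@finite_measure_integrable_cst _ _ _ P setT 1).
have -> : (\int[P]_s ((a - b) * \1_[set s | c s] s + b)%:E)%E =
    (\int[P]_s ((a - b)%:E * (EFin \o I) s + (cst b%:E) s))%E.
  by apply: eq_integral => s _; rewrite EFinD EFinM.
rewrite integralD//; last 2 first.
- exact: integrableZl.
- exact: (@finite_measure_integrable_cst _ _ _ P setT b).
rewrite integralZl// integral_cst// [X in (_ + _ * X)%E](_ : _ = 1%E); last exact: probability_setT.
rewrite (@integral_indic _ _ _ P _ measurableT)// setIT [X in (_ * X + _)%E]Pc.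
by rewrite -EFinM -EFinM -EFinD; congr EFin; lra.
Qed.

Lemma ER_coin r (X Y : T -> R) : (r <= rank j)%N -> L1 r X -> L1 r Y ->
  (forall s, 0 <= X s) -> (forall s, 0 <= Y s) ->
  ER (fun s => if c s then X s else Y s) <= p * ER X + (1 - p) * ER Y.
Proof.
move=> rj LX LY X0 Y0.
have e : ER (fun s => p * X s + (1 - p) * Y s) = p * ER X + (1 - p) * ER Y.
  by rewrite (ERD (L1Z p LX) (L1Z (1 - p) LY)) (ERZ _ LX) (ERZ _ LY).
rewrite -e.
have Lc := @L1_coin r (rank j).+1 X Y (leqnn _) (leqW rj) LX LY.
rewrite -lee_fin -(ExpectE Lc).
apply: (@decouple_le j r (fun s' s => if c s' then X s else Y s)) => //.
- apply: measurable_fun_ifT.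
  + exact: (measurableT_comp coin_measurable (@measurable_fst _ _ (srcT j) (pastT r))).
  + exact: (measurableT_comp LX.1 (@measurable_snd _ _ (srcT j) (pastT r))).
  + exact: (measurableT_comp LY.1 (@measurable_snd _ _ (srcT j) (pastT r))).
- by move=> s' s; case: ifP.
- by apply: L1D; exact: L1Z.
- by move=> s; rewrite coin_fixed.
Qed.

End Coin.

Section Compress.
Variables (d : nat) (j : J) (C : T -> vec R d -> vec R d).
Hypothesis mC : random_map_in (F j) C.

Lemma compress_vmeas r r' (X : T -> vec R d) : (rank j < r')%N -> (r <= r')%N ->
  vmeas (X : pastT r -> vec R d) -> vmeas ((fun s => C s (X s)) : pastT r' -> vec R d).
Proof.
move=> jr rr mX; apply/vmeasP => i.
apply: (measurableT_comp (mC i) (_ : measurable_fun setT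
  ((fun s => (s, X s)) : pastT r' -> (srcT j * vecm R d)%type))).
apply/measurable_fun_pairP; split.
- by move=> _ B mB; rewrite setTI; exact: (srcT_past hF jr mB).
- exact: (past_mono rr mX).
Qed.

(** The compressor reads the fresh source and its argument reads the past, which is the product form
    required by Tonelli. *)
Lemma compress_joint r (X : T -> vec R d) : vmeas (X : pastT r -> vec R d) ->
  vmeas ((fun z => C z.1 (X z.2)) : (srcT j * pastT r)%type -> vec R d).
Proof.
move=> mX; apply/vmeasP => i.
apply: (measurableT_comp (mC i) (_ : measurable_fun setT
  ((fun z => (z.1, X z.2)) : (srcT j * pastT r)%type -> (srcT j * vecm R d)%type))).
apply/measurable_fun_pairP; split; first exact: measurable_fst.
exact: (measurableT_comp mX (@measurable_snd _ _ (srcT j) (pastT r))).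
Qed.

Lemma vmeas_snd r (X : T -> vec R d) : vmeas (X : pastT r -> vec R d) ->
  vmeas ((fun z => X z.2) : (srcT j * pastT r)%type -> vec R d).
Proof. by move=> mX; exact: (measurableT_comp mX (@measurable_snd _ _ (srcT j) (pastT r))). Qed.

Variable K : R.
Hypothesis hK : forall x, (Expect P (fun s => sqnorm (C s x - x)%R) <= (K * sqnorm x)%:E)%E.

(** Serves both classes of compressors, with K = omega or K = 1 - alpha. Square integrability of the
    error is part of the conclusion. *)
Lemma compress_err r r' (X : T -> vec R d) :
  (r <= rank j)%N -> (rank j < r')%N -> L2 r X ->
  L2 r' (fun s => C s (X s) - X s) /\
  ER (fun s => sqnorm (C s (X s) - X s)) <= K * ER (fun s => sqnorm (X s)).
Proof.
move=> rj jr LX; have rr : (r <= r')%N := leq_trans rj (ltnW jr).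
have mE : vmeas ((fun s => C s (X s) - X s) : pastT r' -> vec R d).
  by apply: vmeasB; [exact: compress_vmeas LX.1|exact: (past_mono rr LX.1)].
have mS := measurable_dot mE mE.
have bnd : (\int[P]_s (sqnorm (C s (X s) - X s))%:E
    <= (K * ER (fun s => sqnorm (X s)))%:E)%E.
  rewrite -(ERZ _ (L2_sq LX)).
  apply: (@decouple_le j r (fun s' s => sqnorm (C s' (X s) - X s))) => //.
  - have mD := vmeasB (compress_joint LX.1) (vmeas_snd LX.1).
    exact: (measurable_dot mD mD).
  - by move=> *; exact: sqnorm_ge0.
  - by apply: L1Z; exact: L2_sq.
  - by move=> s; exact: hK.
have [LE EE] := L1_finite mS (fun s => sqnorm_ge0 _) bnd.
by split => //; split => //; exact: LE.2.
Qed.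

Lemma compress_L2 r r' (X : T -> vec R d) :
  (r <= rank j)%N -> (rank j < r')%N -> L2 r X -> L2 r' (fun s => C s (X s)).
Proof.
move=> rj jr LX; have [LE _] := compress_err rj jr LX.
have rr : (r <= r')%N := leq_trans rj (ltnW jr).
have := L2D hF LE (L2_mono rr LX).
by under eq_fun do rewrite subrK.
Qed.

End Compress.

Section Unbiased.
Variables (d : nat) (j : J) (C : T -> vec R d -> vec R d) (om : R).
Hypothesis mC : random_map_in (F j) C.
Hypothesis UC : in_U P om C.

(** After expansion of the square, the cross term has mean zero coordinate by coordinate, and only
    the variance is added. Here [x] and [y] are constants; the random case follows by freezing
    them. *)
Lemma unbiased_fixed (a : R) (x y : vec R d) :
  (\int[P]_s (sqnorm (y + a *: (C s x - x)))%:E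
     <= (sqnorm y + a ^+ 2 * (om * sqnorm x))%:E)%E.
Proof.
pose r := (rank j).+1.
have [LV EV] := compress_err mC (fun x => (UC x).2) (leq0n _) (leqnn r) (L2_cst P rank hF 0 x).
rewrite ER_cst in EV.
pose V s := C s x - x.
have LVi i : L1 r (fun s => coord (V s) i).
  have [iC _] := (UC x).1 i.
  have /vmeasP mV := LV.1; split; first exact: mV.
  rewrite (_ : _ \o _ = (fun s => (coord (C s x) i)%:E) \- cst (coord x i)%:E)%E.
    apply: integrableB => //; exact: (@finite_measure_integrable_cst _ _ _ P setT).
  by apply/funext => s /=; rewrite /V coordD coordN EFinB.
have EVi i : ER (fun s => coord (V s) i) = 0.
  have [iC eC] := (UC x).1 i.
  transitivity (ER (fun s => coord (C s x) i - coord x i)).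
    by congr ER; apply/funext => s; rewrite /V coordD coordN.
  rewrite /ER RintegralB//; last exact: (@finite_measure_integrable_cst _ _ _ P setT).
  by rewrite {1}/Rintegral eC -/(ER (fun=> coord x i)) ER_cst subrr.
have LyV := L1_dot hF (L2_cst P rank hF r y) LV.
have EyV : ER (fun s => dot y (V s)) = 0.
  transitivity (\sum_i ER (fun s => coord y i * coord (V s) i)).
    by rewrite -(ER_sum _ (fun i => L1Z (coord y i) (LVi i))).
  by apply: big1 => i _; rewrite (ERZ _ (LVi i)) EVi mulr0.
have LS : L2 r (fun s => y + a *: V s) by apply: L2D => //; [exact: L2_cst|exact: L2Z].
have /ExpectE := L2_sq LS; rewrite /Expect => ->; rewrite lee_fin.
have -> : (fun s => sqnorm (y + a *: V s)) =
   (fun s => sqnorm y + (2 * a * dot y (V s) + a ^+ 2 * sqnorm (V s))).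
  by apply/funext => s; rewrite sqnormD dotZr sqnormZ addrA mulrA.
have L1a := L1Z (2 * a) LyV; have L1b := L1Z (a ^+ 2) (L2_sq LV).
rewrite (ERD (L1_cst P F rank r (sqnorm y)) (L1D L1a L1b)) ER_cst (ERD L1a L1b).
rewrite (ERZ _ LyV) EyV mulr0 add0r (ERZ _ (L2_sq LV)) lerD2l.
by rewrite ler_wpM2l// sqr_ge0.
Qed.

Lemma unbiased_step r (a : R) (X Y : T -> vec R d) : (r <= rank j)%N ->
  L2 r X -> L2 r Y ->
  ER (fun s => sqnorm (Y s + a *: (C s (X s) - X s)))
    <= ER (fun s => sqnorm (Y s)) + a ^+ 2 * (om * ER (fun s => sqnorm (X s))).
Proof.
move=> rj LX LY.
have [LV _] := compress_err mC (fun x => (UC x).2) rj (leqnn (rank j).+1) LX.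
have LS : L2 (rank j).+1 (fun s => Y s + a *: (C s (X s) - X s)).
  by apply: L2D => //; [exact: L2_mono (leqW rj) LY|exact: L2Z].
rewrite -lee_fin -(ExpectE (L2_sq LS)).
have LX2 := L2_sq LX; have LY2 := L2_sq LY.
rewrite -(ERZ _ LX2) -(ERZ _ (L1Z om LX2)) -(ERD LY2 (L1Z (a ^+ 2) (L1Z om LX2))).
apply: (@decouple_le j r (fun s' s => sqnorm (Y s + a *: (C s' (X s) - X s)))) => //.
- have mD := vmeasB (compress_joint mC LX.1) (vmeas_snd (j := j) LX.1).
  have mD' := vmeasD (vmeas_snd (j := j) LY.1) (vmeasZ a mD).
  exact: (measurable_dot mD' mD').
- by move=> *; exact: sqnorm_ge0.
- by apply: L1D => //; do 2 apply: L1Z.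
- by move=> s; exact: unbiased_fixed.
Qed.

End Unbiased.

(** Induction on the number of workers: compressor i has rank r0 + i, so the errors of the preceding
    workers belong to its past and are absorbed into [Y]. Variances add without cross terms, which
    is the origin of the factor 1/n in the noise. *)
Lemma unbiased_sum d n r0 (jj : 'I_n -> J) (C : 'I_n -> T -> vec R d -> vec R d) (om a : R)
    (X : 'I_n -> T -> vec R d) (Y : T -> vec R d) :
  (forall i, rank (jj i) = (r0 + i)%N) ->
  (forall i, random_map_in (F (jj i)) (C i)) -> (forall i, in_U P om (C i)) ->
  (forall i, L2 r0 (X i)) -> L2 r0 Y ->
  ER (fun s => sqnorm (Y s + a *: \sum_i (C i s (X i s) - X i s)))
    <= ER (fun s => sqnorm (Y s)) + a ^+ 2 * (om * \sum_i ER (fun s => sqnorm (X i s))).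
Proof.
move=> rk mC UC LX LY.
elim: n jj C X rk mC UC LX => [|n IH] jj C X rk mC UC LX.
  rewrite big_ord0 !mulr0 addr0; under eq_fun do rewrite big_ord0 scaler0 addr0.
  exact: lexx.
pose w := widen_ord (leqnSn n).
under eq_fun do rewrite big_ord_recr scalerDr addrA.
rewrite big_ord_recr/= [in leRHS]mulrDr [in leRHS]mulrDr addrA.
have LE i : L2 (r0 + n)%N (fun s => C (w i) s (X (w i) s)
    - X (w i) s).
  have := @compress_err d (jj (w i)) (C (w i))
    (mC _) om (fun x => (UC _ x).2) r0 (r0 + n)%N (X (w i)).
  by rewrite rk leq_addr/= ltn_add2l => /(_ isT (ltn_ord i) (LX _)) [].
apply: le_trans (@unbiased_step d (jj ord_max) (C ord_max) om (mC _) (UC _) (r0 + n)%N a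
  (X ord_max) _ _ _ _) _ => //.
- by rewrite rk.
- exact: L2_mono (leq_addr _ _) (LX _).
- apply: L2D => //; first exact: L2_mono (leq_addr _ _) LY.
  by apply: L2Z => //; exact: L2_sum.
rewrite lerD2r.
exact: (IH (jj \o w) (fun i => C (w i)) (fun i => X (w i)) (fun i => rk (w i))
  (fun i => mC (w i)) (fun i => UC (w i)) (fun i => LX (w i))).
Qed.

End Compressors.

(** * Scalar inequalities *)

Ltac nonneg := repeat first [ assumption | exact: ler0n | exact: ler01 | exact: sqr_ge0
  | (apply: ltW; assumption) | apply: exprn_ge0 | rewrite invr_ge0 | apply: addr_ge0 | apply: mulr_ge0 ].

(** * The quadratic equation for the step size *)

Section Roots.
Context (R : realType).
Variables (p Lbar mu : R).
Hypotheses (p0 : 0 < p) (Lbar0 : 0 < Lbar) (mu0 : 0 <= mu).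

Definition step_eq (G r : R) : R :=
  p * Lbar * G * r ^+ 2 + p * (Lbar + G * mu) * r - (Lbar + G * mu).

(** The quadratic formula exhibits a positive root, and [r] dominates all roots. *)
Lemma step_root_gt0 (G r : R) : 0 < G -> (forall r', step_eq G r' = 0 -> r' <= r) -> 0 < r.
Proof.
move=> G0 rmax.
pose a := p * Lbar * G; pose A := Lbar + G * mu.
have a0 : 0 < a by rewrite !mulr_gt0.
have A0 : 0 < A by rewrite ltr_wpDr// mulr_ge0// ltW.
pose D := (p * A) ^+ 2 + 4 * a * A.
have D0 : 0 <= D by rewrite addr_ge0 ?sqr_ge0// !mulr_ge0// ltW.
pose s := Num.sqrt D.
have s2 : s ^+ 2 = D by rewrite sqr_sqrtr.
have s0 : 0 <= s by exact: sqrtr_ge0.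
have spA : p * A < s.
  have pA0 : 0 < p * A by rewrite mulr_gt0.
  rewrite -(@ltr_pXn2r _ 2)// ?nnegrE ?(ltW pA0)// s2 /D ltrDl !mulr_gt0//.
apply: lt_le_trans (rmax ((s - p * A) / (2 * a)) _).
  by rewrite divr_gt0// ?mulr_gt0// subr_gt0.
rewrite /step_eq -/a -/A.
have -> : a * ((s - p * A) / (2 * a)) ^+ 2 + p * A * ((s - p * A) / (2 * a)) - A
  = (s ^+ 2 - D) / (4 * a).
  by rewrite /D; field; rewrite gt_eqF.
by rewrite s2 subrr mul0r.
Qed.

Lemma step_eq_le (G r th : R) : 0 < G -> step_eq G r = 0 -> 0 <= th -> th <= r -> step_eq G th <= 0.
Proof.
move=> G0 e th0 thr; rewrite -[leRHS]e /step_eq.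
have A0 : 0 <= Lbar + G * mu by rewrite addr_ge0 ?mulr_ge0// ltW.
have a0 : 0 <= p * Lbar * G by rewrite !mulr_ge0// ltW.
have h1 : p * Lbar * G * th ^+ 2 <= p * Lbar * G * r ^+ 2.
  by rewrite ler_wpM2l// lerXn2r// nnegrE// (le_trans th0).
have h2 : p * (Lbar + G * mu) * th <= p * (Lbar + G * mu) * r.
  by rewrite ler_wpM2l// mulr_ge0// ltW.
lra.
Qed.

(** At a root [r] for [G], the identity G step_eq(G', r) = (1 - p r) Lbar (G' - G) shows that the
    polynomial of [G'] is already nonnegative. It is strictly increasing on positive reals, so its
    root cannot lie beyond [r]. *)
Lemma step_root_mono (G G' r r' : R) : 0 < G -> G <= G' -> 0 < r -> 0 < r' ->
  step_eq G r = 0 -> step_eq G' r' = 0 -> r' <= r.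
Proof.
move=> G0 GG' r0 r'0 e e'; rewrite leNgt; apply/negP => rr'.
have G'0 := lt_le_trans G0 GG'.
have A0 : 0 < Lbar + G * mu by rewrite ltr_wpDr ?mulr_ge0// ltW.
have A'0 : 0 < Lbar + G' * mu by rewrite ltr_wpDr ?mulr_ge0// ltW.
have e1 : p * Lbar * G * r ^+ 2 = (Lbar + G * mu) * (1 - p * r).
  by move: e; rewrite /step_eq; lra.
have pr : 0 <= 1 - p * r.
  by rewrite -(pmulr_rge0 _ A0) -e1 !mulr_ge0// ?sqr_ge0// ltW.
have h0 : 0 <= step_eq G' r.
  rewrite -(pmulr_rge0 _ G0).
  have -> : G * step_eq G' r = (1 - p * r) * Lbar * (G' - G).
    transitivity (G' * (p * Lbar * G * r ^+ 2) - G * (Lbar + G' * mu) * (1 - p * r)).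
      by rewrite /step_eq; ring.
    by rewrite e1; ring.
  by rewrite mulr_ge0 ?subr_ge0// mulr_ge0// ltW.
have : step_eq G' r < step_eq G' r'.
  rewrite /step_eq ltrD2r ltrD//.
    by rewrite ltr_pM2l ?mulr_gt0// ltr_pXn2r// nnegrE ltW.
  by rewrite ltr_pM2l// mulr_gt0.
by rewrite e'; lra.
Qed.

End Roots.

(** * Balance of the constants of the potential *)

Section Lyapunov.
Context (R : realType).
Variables (L Lm om nn al p tau be Lb : R).
Hypotheses (L0 : 0 <= L) (Lm0 : 0 <= Lm) (om0 : 0 <= om) (n0 : 0 < nn).
Hypotheses (al0 : 0 < al) (al1 : al <= 1) (p0 : 0 < p).
Hypotheses (tau0 : 0 < tau) (be0 : 0 < be) (be1 : be <= 1).
Hypothesis Lb0 : 0 < Lb.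
(* Weaker than the [1 / 660508] of the theorem, but sufficient. *)
Let e : R := 1 / 100 / 100.
(** [b1] to [b6] are the members of the maximum divided by Lbar, with the third and fourth squared
    to remove the roots. [b56], the geometric mean of [b5] and [b6], is the mixed term that kappa
    produces. *)
Let b1 := L / (al * Lb).
Let b2 := L * p / (al * tau * Lb).
Let b3 := L * Lm * p ^+ 2 * om * tau / (al ^+ 2 * be ^+ 2 * nn * Lb ^+ 2).
Let b4 := L * Lm * p * om * tau / (al ^+ 2 * be * nn * Lb ^+ 2).
Let b5 := Lm * om * p ^+ 2 / (be ^+ 2 * nn * Lb).
Let b6 := Lm * om / (nn * Lb).
Let b56 := Lm * om * p / (be * nn * Lb).
Hypotheses (hb1 : b1 <= e) (hb2 : b2 <= e) (hb3 : b3 <= e ^+ 2) (hb4 : b4 <= e ^+ 2)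
  (hb5 : b5 <= e) (hb6 : b6 <= e).

Definition lyap_rho := 64 * L / (al ^+ 2 * Lb ^+ 2).
Definition lyap_lam := 512 * p * L / (tau * al ^+ 2 * Lb ^+ 2).
Definition lyap_kappa :=
  (16 * p * om / (nn * Lb) + 4096 * p * tau * L * om / (al ^+ 2 * Lb ^+ 2 * nn)) / be.
Definition lyap_nu (th : R) := 8 * L / al * p * th ^+ 2.

Lemma lyap_rho_ge0 : 0 <= lyap_rho.
Proof. rewrite /lyap_rho; nonneg. Qed.

Lemma lyap_lam_ge0 : 0 <= lyap_lam.
Proof. rewrite /lyap_lam; nonneg. Qed.

Lemma lyap_kappa_ge0 : 0 <= lyap_kappa.
Proof.
rewrite /lyap_kappa; nonneg.
Qed.

Lemma lyap_nu_ge0 th : 0 <= lyap_nu th.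
Proof. rewrite /lyap_nu; nonneg. Qed.

Let kap := lyap_kappa.
Let lam := lyap_lam.
Let rho := lyap_rho.
Let cb := 1 + 2 * p / be.
Let ct := 1 + 2 * p / tau.
Let on := om / nn.

Let ne : (al != 0) * (be != 0) * (tau != 0) * (nn != 0) * (Lb != 0).
Proof. by rewrite !gt_eqF. Qed.

Let b10 : 0 <= b1. Proof. rewrite /b1; nonneg. Qed.
Let b20 : 0 <= b2. Proof. rewrite /b2; nonneg. Qed.
Let b40 : 0 <= b4. Proof. rewrite /b4; nonneg. Qed.
Let b50 : 0 <= b5. Proof. rewrite /b5; nonneg. Qed.
Let b60 : 0 <= b6. Proof. rewrite /b6; nonneg. Qed.
Let b560 : 0 <= b56. Proof. rewrite /b56; nonneg. Qed.
Let e0 : 0 < e. Proof. by rewrite /e; lra. Qed.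

Let hb56 : b56 <= e.
Proof.
rewrite -(@ler_pXn2r _ 2)// ?nnegrE ?(ltW e0)//.
have -> : b56 ^+ 2 = b5 * b6 by rewrite /b56 /b5 /b6; field; rewrite !ne.
by rewrite expr2; apply: ler_pM.
Qed.

Let kapE : kap * Lm * cb = 16 * (b56 + 2 * b5) + 4096 * (b4 + 2 * b3).
Proof. by rewrite /kap /lyap_kappa /cb /b56 /b5 /b4 /b3; field; rewrite !ne. Qed.

Let lamE : lam * L * ct = 512 * (b1 * b2 + 2 * b2 ^+ 2).
Proof. by rewrite /lam /lyap_lam /ct /b1 /b2; field; rewrite !ne. Qed.

Let lamE2 : lam * tau ^+ 2 * on * Lm = 512 * (be * b4).
Proof. by rewrite /lam /lyap_lam /on /b4; field; rewrite !ne. Qed.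

Let rhoE : rho * L = 64 * b1 ^+ 2.
Proof. by rewrite /rho /lyap_rho /b1; field; rewrite !ne. Qed.

(** These four products are the prices of gradient drift in [H], [V] (directly and through the
    noise) and [K]. The identities above write them in the [b]s; with every ratio of order 10^-4,
    even the factor 4096 leaves them below 1/100. *)
Let small : [/\ kap * Lm * cb <= 1 / 100, lam * L * ct <= 1 / 100,
  lam * tau ^+ 2 * on * Lm <= 1 / 100 & rho * L <= 1 / 100].
Proof.
have b12 : b1 * b2 <= e * e by apply: ler_pM.
have b22 : b2 ^+ 2 <= e * e by rewrite expr2; apply: ler_pM.
have b11 : b1 ^+ 2 <= e * e by rewrite expr2; apply: ler_pM.
have bb : be * b4 <= b4 by rewrite ler_piMl.
have ee : e * e <= 1 / 100 / 100 * e by rewrite ler_wpM2r// ltW.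
have e1 : e <= 1 / 100 / 100 by rewrite lexx.
rewrite kapE lamE lamE2 rhoE; have h3 := hb3; have h4 := hb4; rewrite expr2 in h3 h4.
have h5 := hb5; have h6 := hb56.
by split; lra.
Qed.

Section Step.
Variables (th nu nu' m : R).
Hypotheses (th0 : 0 < th) (th4 : th <= 1 / 4).
Hypotheses (pal : p * th <= al / 4) (ptau : p * th <= tau / 4) (pbe : p * th <= be / 4).
Variable tt : R.
Hypotheses (tt0 : 0 <= tt) (nutt : nu' * tt <= 8 * p * L / (al * Lb ^+ 2)).
Hypotheses (nuE : nu = 8 * L / al * p * th ^+ 2) (nu'nu : nu' <= nu) (nu'0 : 0 <= nu').

Variables (H K V W U S D sg H' K' V' W' : R).
Hypotheses (H0 : 0 <= H) (K0 : 0 <= K) (V0 : 0 <= V) (W0 : 0 <= W)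
  (S0 : 0 <= S) (D0 : 0 <= D).
Let Q1 := 2 * L * Lm * th ^+ 2 * S + 4 * Lm * D.
Let Q2 := 2 * L ^+ 2 * th ^+ 2 * S + 4 * L * D.
Hypotheses (hsg : sg <= on * (4 * Lm * D + 2 * H))
  (hH : H' <= (1 - be / 2) * H + p * cb * Q1)
  (hV : V' <= (1 - tau / 2) * V + p * ct * Q2 + tau ^+ 2 * on * (2 * H + 2 * p * Q1))
  (hK : K' <= (1 - p) * K + 2 * p * V + 2 * p * Q2)
  (hW : W' <= (1 - al / 2) * W + 2 / al * tt * (2 * K + 4 * L * D) + tt * sg)
  (hS : S <= 2 * U + 2 * W).

(** The inequality is linear in [H], [K], [V], [W], [S], [D], [U], so it is checked one coefficient
    at a time. [cH], [cV], [cK] and [cW] express that what remains of each contraction pays the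
    debts in that variable; [cS] and [cD] collect the drift. *)
Lemma lyap_scalar :
  p / Lb * sg - 2 * p * th ^+ 2 * L * U - 3 / 4 * p * D + p * L * th ^+ 2 / 2 * S
    + (kap * H' + nu' * W' + rho * K' + lam * V')
  <= (1 - p * th) * (kap * H + nu * W + rho * K + lam * V).
Proof.
have [s1 s2 s3 s4] := small.
have kap0 : 0 <= kap := lyap_kappa_ge0.
have lam0 : 0 <= lam := lyap_lam_ge0.
have rho0 : 0 <= rho := lyap_rho_ge0.
have on0 : 0 <= on by rewrite divr_ge0// ltW.
have ntt0 : 0 <= nu' * tt by rewrite mulr_ge0.
have pth0 : 0 <= p * th by rewrite mulr_ge0// ltW.
have cH : p / Lb * on * 2 + kap * (1 - be / 2) + lam * tau ^+ 2 * on * 2 + nu' * tt * on * 2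
    <= (1 - p * th) * kap.
  have h1 : p * th * kap <= be / 4 * kap by rewrite ler_wpM2r.
  have h2 : be / 4 * kap = 4 * (p / Lb * on) + lam * tau ^+ 2 * on * 2.
    by rewrite /kap /lyap_kappa /lam /lyap_lam /on; field; rewrite !ne.
  have h3 : nu' * tt * on * 2 <= 16 * b1 * (p / Lb * on).
    have -> : 16 * b1 * (p / Lb * on) = 8 * p * L / (al * Lb ^+ 2) * on * 2.
      by rewrite /b1; field; rewrite !ne.
    by rewrite ler_wpM2r// ler_wpM2r.
  have h4 : 16 * b1 * (p / Lb * on) <= 2 * (p / Lb * on).
    rewrite ler_wpM2r//; first by rewrite mulr_ge0// divr_ge0// ltW.
    by move: hb1; rewrite /e; lra.
  lra.
have cV : lam * (1 - tau / 2) + 2 * p * rho <= (1 - p * th) * lam.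
  have h1 : p * th * lam <= tau / 4 * lam by rewrite ler_wpM2r.
  have h2 : tau / 4 * lam = 2 * p * rho.
    by rewrite /rho /lyap_rho /lam /lyap_lam; field; rewrite !ne.
  lra.
have cK : rho * (1 - p) + nu' * tt * (4 / al) <= (1 - p * th) * rho.
  have h1 : p * th * rho <= p / 4 * rho.
    by rewrite ler_wpM2r//; move: th4 p0; nra.
  have h3 : nu' * tt * (4 / al) <= p * rho / 2.
    have -> : p * rho / 2 = 8 * p * L / (al * Lb ^+ 2) * (4 / al).
      by rewrite /rho /lyap_rho; field; rewrite !ne.
    by rewrite ler_wpM2r// divr_ge0// ltW.
  have := mulr_ge0 (ltW p0) rho0; lra.
have cW : nu' * (1 - al / 2) + 2 * (p * th ^+ 2 * L) <= (1 - p * th) * nu.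
  have nu0 : 0 <= nu := le_trans nu'0 nu'nu.
  have h1 : p * th * nu <= al / 4 * nu by rewrite ler_wpM2r.
  have h2 : al / 4 * nu = 2 * (p * th ^+ 2 * L) by rewrite nuE; field; rewrite !ne.
  have h3 : nu' * (1 - al / 2) <= nu * (1 - al / 2) by rewrite ler_wpM2r//; move: al1; lra.
  lra.
pose pL := p * th ^+ 2 * L.
have pL0 : 0 <= pL by rewrite /pL !mulr_ge0// ?sqr_ge0// ltW.
(* The whole [S] coefficient is charged to [pL]. Through S <= 2U + 2W, half of the charge cancels
   the available - 2 p theta^2 L [U] and the other half is the debt already counted in [cW]. *)
have cS : p * L * th ^+ 2 / 2 + kap * (p * cb) * (2 * L * Lm * th ^+ 2)
     + lam * (p * ct) * (2 * L ^+ 2 * th ^+ 2)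
     + lam * (tau ^+ 2 * on) * (2 * p) * (2 * L * Lm * th ^+ 2)
     + rho * (2 * p) * (2 * L ^+ 2 * th ^+ 2) <= pL.
  have -> : p * L * th ^+ 2 / 2 + kap * (p * cb) * (2 * L * Lm * th ^+ 2)
     + lam * (p * ct) * (2 * L ^+ 2 * th ^+ 2)
     + lam * (tau ^+ 2 * on) * (2 * p) * (2 * L * Lm * th ^+ 2)
     + rho * (2 * p) * (2 * L ^+ 2 * th ^+ 2)
     = pL * (1 / 2 + 2 * (kap * Lm * cb) + 2 * (lam * L * ct)
       + 4 * (lam * tau ^+ 2 * on * Lm) + 4 * (rho * L)) by rewrite /pL; field.
  by rewrite ler_piMr//; lra.
(* The budget 3/4 p is what p (1 - theta) guarantees for theta at most 1/4. *)
have cD : p / Lb * on * (4 * Lm) + kap * (p * cb) * (4 * Lm) + lam * (p * ct) * (4 * L)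
     + lam * (tau ^+ 2 * on) * (2 * p) * (4 * Lm) + rho * (2 * p) * (4 * L)
     + nu' * tt * (2 / al) * (4 * L) + nu' * tt * on * (4 * Lm) <= 3 / 4 * p.
  have h1 : p / Lb * on * (4 * Lm) = 4 * (p * b6).
    by rewrite /on /b6; field; rewrite !ne.
  have h2 : nu' * tt * (2 / al) * (4 * L) <= 64 * (p * b1 ^+ 2).
    have -> : 64 * (p * b1 ^+ 2) = 8 * p * L / (al * Lb ^+ 2) * (2 / al) * (4 * L).
      by rewrite /b1; field; rewrite !ne.
    by rewrite ler_wpM2r ?mulr_ge0// ler_wpM2r// divr_ge0// ltW.
  have h3 : nu' * tt * on * (4 * Lm) <= 32 * (p * (b1 * b6)).
    have -> : 32 * (p * (b1 * b6)) = 8 * p * L / (al * Lb ^+ 2) * on * (4 * Lm).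
      by rewrite /b1 /b6 /on; field; rewrite !ne.
    by rewrite ler_wpM2r ?mulr_ge0// ler_wpM2r.
  have h4 : kap * (p * cb) * (4 * Lm) + lam * (p * ct) * (4 * L)
     + lam * (tau ^+ 2 * on) * (2 * p) * (4 * Lm) + rho * (2 * p) * (4 * L)
    = p * (4 * (kap * Lm * cb) + 4 * (lam * L * ct) + 8 * (lam * tau ^+ 2 * on * Lm)
       + 8 * (rho * L)) by field.
  have b11 : b1 ^+ 2 <= e * e by rewrite expr2; apply: ler_pM.
  have b16 : b1 * b6 <= e * e by apply: ler_pM.
  have ee : e * e <= 1 / 100 / 100 * e by rewrite ler_wpM2r// ltW.
  have e1 : e <= 1 / 100 / 100 by rewrite lexx.
  have h6 : b6 <= e := hb6.
  have h5 : 4 * b6 + 64 * b1 ^+ 2 + 32 * (b1 * b6) + (4 * (kap * Lm * cb) + 4 * (lam * L * ct)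
       + 8 * (lam * tau ^+ 2 * on * Lm) + 8 * (rho * L)) <= 3 / 4 by lra.
  have := ler_wpM2l (ltW p0) h5; lra.
have mH := ler_wpM2r H0 cH; have mV := ler_wpM2r V0 cV; have mK := ler_wpM2r K0 cK.
have mW := ler_wpM2r W0 cW; have mS := ler_wpM2r S0 cS; have mD := ler_wpM2r D0 cD.
have mS' := ler_wpM2l pL0 hS.
have kH := ler_wpM2l kap0 hH; have kV := ler_wpM2l lam0 hV; have kK := ler_wpM2l rho0 hK.
have kW := ler_wpM2l nu'0 hW.
have ksg := ler_wpM2l (_ : 0 <= p / Lb) hsg; have {}ksg := ksg (divr_ge0 (ltW p0) (ltW Lb0)).
have ksg2 := ler_wpM2l ntt0 hsg.
rewrite /Q1 /Q2 in kH kV kK.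
move: mH mV mK mW mS mD mS' kH kV kK kW ksg ksg2; rewrite /pL.
lra.
Qed.

End Step.
End Lyapunov.

(** * Pathwise inequalities *)

Section Prox.
Context (R : realType) (d : nat).
Implicit Types (a y g x u : vec R d).

Definition prox_pt (A gm mu : R) g a y : vec R d :=
  (A + gm * mu)^-1 *: (A *: a + (gm * mu) *: y - gm *: g).

(** Completing the square around the closed-form minimizer; this yields uniqueness of the minimizer
    in [prox_min]. *)
Lemma prox_objE (A gm mu : R) g a y x : 0 < gm -> A + gm * mu != 0 ->
  prox_obj g A gm mu a y x = prox_obj g A gm mu a y (prox_pt A gm mu g a y)
    + (A + gm * mu) / (2 * gm) * sqnorm (x - prox_pt A gm mu g a y).
Proof.
move=> gm0 A0; rewrite /prox_obj /prox_pt /sqnorm /dot !mulr_sumr -!big_split.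
apply: eq_bigr => j _ /=; rewrite !coordE.
by field; rewrite (gt_eqF gm0) A0.
Qed.

Lemma prox_min (A gm mu : R) g a y x : 0 < gm -> 0 < A + gm * mu ->
  (forall x1, prox_obj g A gm mu a y x <= prox_obj g A gm mu a y x1) ->
  x = prox_pt A gm mu g a y.
Proof.
move=> gm0 A0 /(_ (prox_pt A gm mu g a y)).
rewrite (@prox_objE A gm mu g a y x)// ?gt_eqF// gerDl pmulr_rle0; last first.
  by rewrite divr_gt0// mulr_gt0.
by move/sqnorm_le0/eqP; rewrite subr_eq0 => /eqP.
Qed.

(** Two steps with the same [y] differ linearly in their anchors and gradients. It controls u^{t+1}
    - q^{t+1} and the distance of u^{t+1} to the step with the exact gradient. *)
Lemma prox_ptB (A gm mu : R) g g' a a' y :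
  prox_pt A gm mu g a y - prox_pt A gm mu g' a' y =
  (A / (A + gm * mu)) *: (a - a') - (gm / (A + gm * mu)) *: (g - g').
Proof.
apply: vecP => j; rewrite !coordE; ring.
Qed.

(* Strong convexity of the exact model [x |-> gm <gr, x> + A/2 |x - u|^2 + gm mu/2 |x - y|^2],
   compared at its minimizer, at [xs] and at [x]. *)
Lemma prox_identity (A gm mu : R) (gr u y xs x : vec R d) : A + gm * mu != 0 ->
  let ub := prox_pt A gm mu gr u y in
  gm * dot gr (x - xs) - gm * mu / 2 * sqnorm (y - xs) =
    A / 2 * sqnorm (u - xs) - (A + gm * mu) / 2 * sqnorm (ub - xs)
    + (A + gm * mu) / 2 * sqnorm (x - ub) - A / 2 * sqnorm (x - u)
    - gm * mu / 2 * sqnorm (x - y).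
Proof.
move=> A0 /=; rewrite /prox_pt /sqnorm /dot !mulr_sumr -!sumrN -!big_split.
apply: eq_bigr => j _ /=; rewrite !coordE.
by field.
Qed.

End Prox.

Section Paths.
Context (R : realType) (n d : nat).
Variables (f : 'I_n -> vec R d -> R) (gf : 'I_n -> vec R d -> vec R d) (Li : 'I_n -> R).
Variables (L mu : R) (xs : vec R d).
Hypothesis Lf : forall i, 0 <= Li i /\ smooth_with (Li i) (f i) (gf i).
Hypothesis cf : forall i, convex_fun (f i).
Hypothesis L0 : 0 <= L.
Hypothesis Lsm : smooth_with L (favg f) (gavg gf).
Hypothesis sc : strongly_convex mu (favg f).
Variables (th : R) (u w z h : vec R d).
Hypothesis th01 : 0 < th <= 1.
Let y := th *: w + (1 - th) *: z.
Let x := th *: u + (1 - th) *: z.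
Let S := sqnorm (u - w).
Let D := bregman (favg f) (gavg gf) z y.
Let Lm := Lmax_of Li.
Let Lm0 : 0 <= Lm. Proof. exact: Lmax_ge0. Qed.

(** In this section [u] stands for u^{t+1} while [w] and [z] are the iterates of time t, so the two
    convex combinations share the term in [z]. *)
Let xy : x - y = th *: (u - w).
Proof. by rewrite /x /y; apply: vecP => j; rewrite !coordE; ring. Qed.

Lemma path_D_ge0 : 0 <= D.
Proof. exact: convex_gradient L0 Lsm (convex_avg cf). Qed.

Let bxy : bregman (favg f) (gavg gf) x y <= L / 2 * th ^+ 2 * S.
Proof.
by apply: le_trans (bregman_smooth _ _ L0 Lsm) _; rewrite xy sqnormZ mulrA.
Qed.

Let navg0 : 0 <= n%:R^-1 :> R. Proof. by rewrite invr_ge0. Qed.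

Lemma avg_le2 (a b : 'I_n -> R) (F : 'I_n -> R) (s t : R) :
  (forall i, F i <= s * a i + t * b i) ->
  n%:R^-1 * \sum_i F i <= s * (n%:R^-1 * \sum_i a i) + t * (n%:R^-1 * \sum_i b i).
Proof.
move=> H; rewrite [X in _ <= X + _]mulrCA [X in _ <= _ + X]mulrCA -mulrDr ler_wpM2l//.
by rewrite !mulr_sumr -big_split ler_sum.
Qed.

(** The difference is routed through [y]. From [x] to [y], cocoercivity of the [f i] is followed by
    smoothness of the mean, which gives L Lmax instead of Lmax^2 and hence the root of L Lmax in
    Lbar; from [z] to [y] the Bregman divergence is kept. *)
Lemma path_grad_i : n%:R^-1 * \sum_i sqnorm (gf i x - gf i z)
  <= 2 * L * Lm * th ^+ 2 * S + 4 * Lm * D.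
Proof.
apply: le_trans (avg_le2 (fun i => sqnormB_le2 (gf i x) (gf i y) (gf i z))) _.
under [in X in _ + X]eq_bigr do rewrite sqnormBC.
have h1 := grad_diff_avg Lf cf x y; have h2 := grad_diff_avg Lf cf z y.
have h3 := ler_wpM2l Lm0 bxy.
rewrite -/Lm -/D in h1 h2; move: h1 h2 h3.
move: (n%:R^-1 * _) (n%:R^-1 * _) => a b; lra.
Qed.

Lemma path_grad : sqnorm (gavg gf x - gavg gf z) <= 2 * L ^+ 2 * th ^+ 2 * S + 4 * L * D.
Proof.
apply: le_trans (sqnormB_le2 _ (gavg gf y) _) _.
have := smooth_lip x y L0 Lsm; rewrite xy sqnormZ -/S.
have := cocoercive z y L0 Lsm (convex_avg cf); rewrite -/D sqnormBC.
lra.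
Qed.

Lemma path_noise (hi : 'I_n -> vec R d) : n%:R^-1 * \sum_i sqnorm (gf i y - hi i)
  <= 4 * Lm * D + 2 * (n%:R^-1 * \sum_i sqnorm (hi i - gf i z)).
Proof.
apply: le_trans (avg_le2 (fun i => sqnormB_le2 (gf i y) (gf i z) (hi i))) _.
under [in X in X + _]eq_bigr do rewrite sqnormBC.
under [in X in _ + X]eq_bigr do rewrite sqnormBC.
have := grad_diff_avg Lf cf z y; rewrite -/Lm -/D; lra.
Qed.

Lemma path_k (k : vec R d) : sqnorm (gavg gf y - k) <= 2 * sqnorm (k - gavg gf z) + 4 * L * D.
Proof.
apply: le_trans (sqnormB_le2 _ (gavg gf z) _) _.
rewrite [in X in _ + 2 * X <= _]sqnormBC [in X in 2 * X + _ <= _]sqnormBC.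
have := cocoercive z y L0 Lsm (convex_avg cf); rewrite -/D; lra.
Qed.

Lemma path_v (s : R) (v : vec R d) : 0 < s ->
  sqnorm (v - gavg gf x) <= (1 + s) * sqnorm (v - gavg gf z)
    + (1 + s^-1) * (2 * L ^+ 2 * th ^+ 2 * S + 4 * L * D).
Proof.
move=> s0; rewrite -(subrKA (gavg gf z) v).
apply: le_trans (sqnormD_young _ _ s0) _; rewrite lerD2l ler_wpM2l//.
  by rewrite addr_ge0// invr_ge0 ltW.
by rewrite sqnormBC; exact: path_grad.
Qed.

Lemma path_h (s : R) (hi : 'I_n -> vec R d) : 0 < s ->
  n%:R^-1 * \sum_i sqnorm (gf i x - hi i)
   <= (1 + s) * (n%:R^-1 * \sum_i sqnorm (hi i - gf i z))
    + (1 + s^-1) * (2 * L * Lm * th ^+ 2 * S + 4 * Lm * D).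
Proof.
move=> s0.
have H i : sqnorm (gf i x - hi i) <= (1 + s) * sqnorm (hi i - gf i z)
    + (1 + s^-1) * sqnorm (gf i x - gf i z).
  rewrite -(subrKA (gf i z)) addrC (sqnormBC (hi i)); exact: sqnormD_young.
apply: le_trans (avg_le2 H) _; rewrite lerD2l ler_wpM2l//; last exact: path_grad_i.
by rewrite addr_ge0// invr_ge0 ltW.
Qed.

(** Smoothness bounds f(x) from [y], strong convexity is used towards [xs], and the gap at [z] is
    written exactly with [D], so the term - (1 - theta) [D] survives. The relation between [G] and
    [G'] merges the weights of f(z). *)
Lemma path_main (p G G' gm : R) : 0 <= p -> 0 <= G' -> G = G' * (1 - p * th) ->
  gm = p * th * G' ->
  G' * (p * (favg f x - favg f xs) + (1 - p) * (favg f z - favg f xs))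
  <= G * (favg f z - favg f xs)
     + (gm * dot (gavg gf y) (u - xs) - gm * mu / 2 * sqnorm (y - xs))
     - G' * p * (1 - th) * D + G' * p * L * th ^+ 2 / 2 * S.
Proof.
move=> p0 G'0 -> ->.
have h1 := bxy.
have h2 := strongly_convex_gradient xs y L0 Lsm sc.
(* Splits x - y as theta (u - xs) + theta (xs - y) + (1 - theta) (z - y): one piece for the prox
   step, one for strong convexity, one for [D]. *)
have e1 : dot (gavg gf y) (x - y) =
    th * dot (gavg gf y) (u - xs) + th * dot (gavg gf y) (xs - y)
    + (1 - th) * dot (gavg gf y) (z - y).
  by rewrite -mulrDr -dotDr -!dotZr -dotDr; congr dot; rewrite /x; apply: vecP => j;
    rewrite !coordE; ring.
rewrite (sqnormBC xs) in h2.
rewrite /D; move: h1 h2; rewrite /bregman e1.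
move: (favg f x) (favg f y) (favg f z) (favg f xs) (dot _ (u - xs)) (dot _ (xs - y))
  (dot _ (z - y)) (sqnorm (y - xs)) => fx fy fz fs d1 d2 d3 q h1 h2.
have th0 : 0 <= th by case/andP: th01 => /ltW.
have pG : 0 <= G' * p by rewrite mulr_ge0.
have h3 := ler_wpM2l th0 h2.
have := ler_wpM2l pG (lerD h1 h3); lra.
Qed.

End Paths.

(** * The algorithm *)

Section LinearExpectation.
Context (R : realType) (dT : measure_display) (T : measurableType dT).
Context (P : probability T R).
Local Notation ER := (ER P).

Definition intg (X : T -> R) := P.-integrable setT (EFin \o X).

Fixpoint all_intg (l : seq (R * (T -> R))) : Prop :=
  if l is c :: l' then intg c.2 /\ all_intg l' else True.

Fixpoint lin_comb (l : seq (R * (T -> R))) (s : T) : R :=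
  if l is c :: l' then c.1 * c.2 s + lin_comb l' s else 0.

Fixpoint ER_lin_comb (l : seq (R * (T -> R))) : R :=
  if l is c :: l' then c.1 * ER c.2 + ER_lin_comb l' else 0.

Lemma ER_linE (l : seq (R * (T -> R))) : all_intg l ->
  intg (lin_comb l) /\ ER (lin_comb l) = ER_lin_comb l.
Proof.
elim: l => [_|c l IH [ic /IH [il e]]] /=.
  rewrite ER_cst; split => //.
  rewrite /intg; exact: (@finite_measure_integrable_cst _ _ _ P setT).
have icl : intg (fun s => c.1 * c.2 s).
  rewrite /intg (_ : _ \o _ = fun s => c.1%:E * (EFin \o c.2) s)%E; first exact: integrableZl.
  by apply/funext => s /=; rewrite EFinM.
split.
  rewrite /intg (_ : _ \o _ = (EFin \o (fun s => (c.1 * c.2 s)%R)) \+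
     (EFin \o lin_comb l))%E; first exact: integrableD.
  by apply/funext => s /=; rewrite EFinD.
by rewrite /ER RintegralD// RintegralZl// -e.
Qed.

(** Turns a pointwise linear inequality into one between expectations, with linearity settled once
    for a whole list of coefficients and variables. *)
Lemma ER_le_lin (X : T -> R) l : intg X -> all_intg l ->
  (forall s, X s <= lin_comb l s) -> ER X <= ER_lin_comb l.
Proof.
by move=> iX /ER_linE[il <-] H; apply: le_Rintegral.
Qed.

End LinearExpectation.

(** As [hb] is the mean of the shifts [h i], the shifts cancel and the error of the gradient
    estimator is the mean of the compression errors. *)
Lemma avg_noise (R : realType) (n d : nat) (hb : vec R d) (g h m : 'I_n -> vec R d) :
  hb = n%:R^-1 *: \sum_i h i ->
  hb + n%:R^-1 *: \sum_i m i - n%:R^-1 *: \sum_i g i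
  = n%:R^-1 *: \sum_i (m i - (g i - h i)).
Proof.
move=> ->; rewrite -scalerDr -scalerBr -big_split -sumrB; congr (_ *: _).
by apply: eq_bigr => i _; rewrite opprB addrA (addrC (m i)) addrAC -addrA /=.
Qed.

Lemma contract_drift (R : realType) (a H e : R) : 0 <= a <= 1 -> 0 <= H -> 0 <= e ->
  (1 - a) * ((1 + a / 2) * H + e) <= (1 - a / 2) * H + e.
Proof.
move=> /andP[a0 a1] H0 e0.
have := mulr_ge0 a0 e0; have := mulr_ge0 (sqr_ge0 a) H0; lra.
Qed.

Lemma contract_sq_drift (R : realType) (a H e : R) : 0 <= a <= 1 -> 0 <= H -> 0 <= e ->
  (1 - a) ^+ 2 * ((1 + a / 2) * H + e) <= (1 - a / 2) * H + e.
Proof.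
move=> a01 H0 e0; have /andP[a0 a1] := a01.
have c1 := contract_drift a01 H0 e0; have b0 : 0 <= 1 - a by rewrite subr_ge0.
rewrite expr2 -mulrA; apply: le_trans (ler_wpM2l b0 c1) _; apply: le_trans c1 => //.
rewrite ler_wpM2l// lerD2r ler_wpM2r//; lra.
Qed.

(** Rests on (1 - a)(1 + 2/a) = 2/a - 1 - a: the contraction absorbs the Young factor on [W] and
    leaves only 2/a on the drift. *)
Lemma contract_young (R : realType) (a W tZ ts : R) : 0 < a <= 1 -> 0 <= W -> 0 <= tZ -> 0 <= ts ->
  (1 - a) * ((1 + a / 2) * W + (1 + (a / 2)^-1) * tZ + ts)
    <= (1 - a / 2) * W + 2 / a * tZ + ts.
Proof.
move=> /andP[a0 a1] W0 tZ0 ts0.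
have ca : (1 - a) * (1 + (a / 2)^-1) <= 2 / a.
  have -> : (1 - a) * (1 + (a / 2)^-1) = 2 / a - 1 - a by field; rewrite gt_eqF.
  by move: (ltW a0); lra.
have := ler_wpM2r tZ0 ca; have := mulr_ge0 (sqr_ge0 a) W0; have := mulr_ge0 (ltW a0) ts0.
move: ((a / 2)^-1) (2 / a) => a2 a3; lra.
Qed.

Lemma mix_arith (R : realType) (p a K V Q : R) : 0 <= p -> a <= 2 * V + 2 * Q ->
  p * a + (1 - p) * K <= (1 - p) * K + 2 * p * V + 2 * p * Q.
Proof. by move=> p0 aVQ; have := ler_wpM2l p0 aVQ; lra. Qed.

Lemma descent_arith (R : realType) (G G' p Fx Ff a X a' B E U D D' S S' i : R) : 0 <= i ->
  G' * (p * Fx + (1 - p) * Ff)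
    <= G * Ff + (a * X - a' * B + a' * E - a * U - i) - D * D' + S * S' ->
  G' * p * Fx <= (G - G' * (1 - p)) * Ff + (a * X + (- a' * B + (a' * E + (- a * U
    + (- D * D' + (S * S' + 0)))))).
Proof. lra. Qed.

Lemma descent_arith2 (R : realType) (G G' p F' Fx Ff a X X' a' B E U D D' S S' m : R) :
  0 <= G' -> 0 <= a' -> F' <= p * Fx + (1 - p) * Ff -> X' <= B + m -> E <= m ->
  G' * p * Fx <= (G - G' * (1 - p)) * Ff + (a * X + (- a' * B + (a' * E + (- a * U
    + (- D * D' + (S * S' + 0)))))) ->
  G' * F' + a' * X' <= G * Ff + a * X + 2 * a' * m - a * U - D * D' + S * S'.
Proof.
move=> G0 a0 h1 h2 h3; have := ler_wpM2l G0 h1; have := ler_wpM2l a0 h2.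
have := ler_wpM2l a0 h3; lra.
Qed.

Lemma lyapunov_arith (R : realType) (G G' p th L Lb A a' F F' X X' Y Y' tt sg U D S : R) :
  0 <= G' -> G = G' * (1 - p * th) -> 0 <= p ->
  a' * tt <= G' * (p / Lb) -> 0 <= sg -> 4 * (G' * p * th ^+ 2 * L) <= A -> 0 <= U ->
  th <= 1 / 4 -> 0 <= D ->
  p / Lb * sg - 2 * p * th ^+ 2 * L * U - 3 / 4 * p * D + p * L * th ^+ 2 / 2 * S + Y'
    <= (1 - p * th) * Y ->
  G' * F' + a' / 2 * X' <= G * F + A / 2 * X + a' * tt * sg - A / 2 * U
    - G' * p * (1 - th) * D + G' * p * L * th ^+ 2 / 2 * S ->
  G' * (F' + Y') + a' / 2 * X' <= G * (F + Y) + A / 2 * X.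
Proof.
move=> G'0 -> p0 h1 sg0 h2 U0 th4 D0 hY hF.
have m1 := ler_wpM2r sg0 h1; have m2 := ler_wpM2r U0 h2; have m3 := ler_wpM2l G'0 hY.
have th4' : 0 <= 1 / 4 - th by rewrite subr_ge0.
have m4 := mulr_ge0 (mulr_ge0 (mulr_ge0 G'0 p0) th4') D0.
lra.
Qed.

Lemma quarter_bound (R : realType) (a Lb L : R) : 0 < a -> a <= 1 -> 0 < Lb ->
  L / (a * Lb) <= 1 / 100 / 100 -> 4 * L <= Lb.
Proof.
move=> a0 a1 Lb0; rewrite ler_pdivrMr ?mulr_gt0// => H.
by have := ler_wpM2r (ltW Lb0) a1; lra.
Qed.

Lemma quarter_scale (R : realType) (G p th L Lb : R) : 0 <= G -> 0 <= p -> 4 * L <= Lb ->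
  4 * (G * p * th ^+ 2 * L) <= p * Lb * G * th ^+ 2.
Proof.
move=> G0 p0 LL; have := ler_wpM2l (mulr_ge0 (mulr_ge0 G0 p0) (sqr_ge0 th)) LL; lra.
Qed.

Lemma base_succ n t : (t.+1 * (n * 2 + 2) = t * (n * 2 + 2) + n + 2 + n)%N.
Proof. lia. Qed.

Lemma base_le b n : [/\ b <= b + n + 2 + n, b + n <= b + n + 2 + n,
  b + n + 1 <= b + n + 2 + n & b + n + 2 <= b + n + 2 + n]%N.
Proof. by split; lia. Qed.

(** * Scalar sequences, closed forms and chronology of the iterates *)

Section Algorithm.
Context
  (R : realType) (dT : measure_display) (T : measurableType dT)
  (P : probability T R)
  (n d : nat) (hn : (0 < n)%N)
  (f : 'I_n -> vec R d -> R) (gf : 'I_n -> vec R d -> vec R d)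
  (Li : 'I_n -> R) (L mu : R) (xstar : vec R d)
  (om alpha p tau beta Gamma0 Lbar thetamin : R)
  (x0 : vec R d) (h0 : 'I_n -> vec R d) (k0 v0 : vec R d)
  (CDy CDz : nat -> 'I_n -> T -> vec R d -> vec R d)
  (CP : nat -> T -> vec R d -> vec R d)
  (c : nat -> T -> bool)
  (F : src n -> set (set T))
  (thetabar theta gamma Gam : nat -> R)
  (y u q w x z k v hbar g : nat -> T -> vec R d)
  (h my mz : nat -> 'I_n -> T -> vec R d).
Hypothesis Lf : forall i, 0 <= Li i /\ smooth_with (Li i) (f i) (gf i).
Hypothesis L0 : 0 <= L.
Hypothesis Lsm : smooth_with L (favg f) (gavg gf).
Hypothesis cf : forall i, convex_fun (f i).
Hypothesis mu0 : 0 <= mu.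
Hypothesis sc : strongly_convex mu (favg f).
Hypothesis xmin : forall x1, favg f xstar <= favg f x1.
Hypothesis hF : forall j, sub_sigma (F j).
Hypothesis hI : mutually_independent P F.
Hypothesis mDy : forall t i, random_map_in (F (SrcDy t i)) (CDy t i).
Hypothesis mDz : forall t i, random_map_in (F (SrcDz t i)) (CDz t i).
Hypothesis mP : forall t, random_map_in (F (SrcP n t)) (CP t).
Hypothesis Fcoin : forall t, F (SrcCoin n t) [set s | c t s].
Hypothesis om0 : 0 <= om.
Hypothesis al01 : 0 < alpha <= 1.
Hypothesis UDy : forall t i, in_U P om (CDy t i).
Hypothesis UDz : forall t i, in_U P om (CDz t i).
Hypothesis BP : forall t, in_B P alpha (CP t).
Hypothesis p01 : 0 < p <= 1.
Hypothesis Pcoin : forall t, P [set s | c t s] = p%:E.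
Hypothesis tau01 : 0 < tau <= 1.
Hypothesis Gamma01 : 1 <= Gamma0.
Hypothesis be0 : 0 < beta.
Hypothesis beom : beta <= 1 / (om + 1).
Hypothesis LbarE : Lbar = (6605 * 100 + 8) *
    Num.max (L / alpha)
   (Num.max (L * p / (alpha * tau))
   (Num.max (Num.sqrt (L * Lmax_of Li) * p * Num.sqrt (om * tau)
               / (alpha * beta * Num.sqrt n%:R))
   (Num.max (Num.sqrt (L * Lmax_of Li) * Num.sqrt p * Num.sqrt (om * tau)
               / (alpha * Num.sqrt beta * Num.sqrt n%:R))
   (Num.max (Lmax_of Li * om * p ^+ 2 / (beta ^+ 2 * n%:R))
            (Lmax_of Li * om / n%:R))))).
Hypothesis Lb0 : 0 < Lbar.
Hypothesis thetaminE :
  thetamin = 4^-1 * Num.min 1 (Num.min (alpha / p) (Num.min (tau / p) (beta / p))).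
Hypothesis Gam0 : Gam 0%N = Gamma0.
Hypothesis thetabarE : forall t,
     p * Lbar * Gam t * thetabar t.+1 ^+ 2 + p * (Lbar + Gam t * mu) * thetabar t.+1
       - (Lbar + Gam t * mu) = 0 /\
     (forall r, p * Lbar * Gam t * r ^+ 2 + p * (Lbar + Gam t * mu) * r
                  - (Lbar + Gam t * mu) = 0 -> r <= thetabar t.+1).
Hypothesis thetaE : forall t, theta t.+1 = Num.min (thetabar t.+1) thetamin.
Hypothesis gammaE : forall t, gamma t.+1 = p * theta t.+1 * Gam t / (1 - p * theta t.+1).
Hypothesis GamE : forall t, Gam t.+1 = Gam t + gamma t.+1.
Hypothesis init : forall s, w 0%N s = x0 /\ z 0%N s = x0 /\ u 0%N s = x0.
Hypothesis h_init : forall s i, h 0%N i s = h0 i.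
Hypothesis kv_init : forall s, k 0%N s = k0 /\ v 0%N s = v0.
Hypothesis hbar_init : forall s, hbar 0%N s = n%:R^-1 *: \sum_(i < n) h0 i.
Hypothesis yE : forall t s, y t.+1 s = theta t.+1 *: w t s + (1 - theta t.+1) *: z t s.
Hypothesis myE : forall t i s, my t i s = CDy t i s (gf i (y t.+1 s) - h t i s).
Hypothesis gE : forall t s, g t.+1 s = hbar t s + n%:R^-1 *: \sum_(i < n) my t i s.
Hypothesis umin : forall t s (x1 : vec R d),
     prox_obj (g t.+1 s) (Lbar + Gam t * mu) (gamma t.+1) mu (u t s) (y t.+1 s) (u t.+1 s)
       <= prox_obj (g t.+1 s) (Lbar + Gam t * mu) (gamma t.+1) mu (u t s) (y t.+1 s) x1.
Hypothesis qmin : forall t s (x1 : vec R d),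
     prox_obj (k t s) (Lbar + Gam t * mu) (gamma t.+1) mu (w t s) (y t.+1 s) (q t.+1 s)
       <= prox_obj (k t s) (Lbar + Gam t * mu) (gamma t.+1) mu (w t s) (y t.+1 s) x1.
Hypothesis wE : forall t s, w t.+1 s = q t.+1 s + CP t s (u t.+1 s - q t.+1 s).
Hypothesis xE : forall t s, x t.+1 s = theta t.+1 *: u t.+1 s + (1 - theta t.+1) *: z t s.
Hypothesis kzE : forall t s, (k t.+1 s, z t.+1 s) =
                 (if c t s then (v t s, x t.+1 s) else (k t s, z t s)).
Hypothesis mzE : forall t i s, mz t i s = CDz t i s (gf i (z t.+1 s) - h t i s).
Hypothesis hE : forall t i s, h t.+1 i s = h t i s + beta *: mz t i s.
Hypothesis vE : forall t s, v t.+1 s = (1 - tau) *: v t s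
                           + tau *: (hbar t s + n%:R^-1 *: \sum_(i < n) mz t i s).
Hypothesis hbarE : forall t s, hbar t.+1 s = hbar t s + (beta / n%:R) *: \sum_(i < n) mz t i s.

Let al0 : 0 < alpha. Proof. by case/andP: al01. Qed.
Let al1 : alpha <= 1. Proof. by case/andP: al01. Qed.
Let p0 : 0 < p. Proof. by case/andP: p01. Qed.
Let p1 : p <= 1. Proof. by case/andP: p01. Qed.
Let tau0 : 0 < tau. Proof. by case/andP: tau01. Qed.
Let tau1 : tau <= 1. Proof. by case/andP: tau01. Qed.
Let n0 : 0 < n%:R :> R. Proof. by rewrite ltr0n. Qed.
Let Lm := Lmax_of Li.
Let Lm0 : 0 <= Lm. Proof. exact: Lmax_ge0. Qed.

Let omb : beta * (om + 1) <= 1.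
Proof. by move: beom; rewrite ler_pdivlMr// ltr_wpDl. Qed.

Let be1 : beta <= 1.
Proof. by apply: le_trans omb; rewrite ler_peMr ?(ltW be0)// lerDr. Qed.

Lemma thetamin_gt0 : 0 < thetamin.
Proof. by rewrite thetaminE mulr_gt0 ?invr_gt0// !lt_min ltr01 !divr_gt0. Qed.

Lemma theta_bounds t : [/\ theta t.+1 <= 1 / 4, p * theta t.+1 <= alpha / 4,
  p * theta t.+1 <= tau / 4 & p * theta t.+1 <= beta / 4].
Proof.
have tE := thetaminE; set m := Num.min 1 _ in tE.
have tm : theta t.+1 <= 4^-1 * m by rewrite thetaE -tE ge_min lexx orbT.
have key a : m <= a / p -> p * theta t.+1 <= a / 4.
  rewrite ler_pdivlMr// => H.
  apply: le_trans (_ : p * (4^-1 * m) <= _); first by rewrite ler_wpM2l// ltW.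
  lra.
split.
- apply: le_trans tm _; have : m <= 1 by rewrite /m ge_min lexx.
  lra.
- by apply: key; rewrite /m !ge_min lexx !orbT.
- by apply: key; rewrite /m !ge_min lexx !orbT.
- by apply: key; rewrite /m !ge_min lexx !orbT.
Qed.

(** Positivity of theta_{t+1} needs Gamma_t > 0 and growth of Gamma needs theta > 0; the conditional
    form lets [Gam_ge1] close the loop by induction. *)
Let theta_gt0' t : 0 < Gam t -> 0 < theta t.+1.
Proof.
move=> G0; rewrite thetaE lt_min thetamin_gt0 andbT.
exact: (step_root_gt0 p0 Lb0 mu0 G0 (thetabarE t).2).
Qed.

Lemma Gam_ge1 t : 1 <= Gam t.
Proof.
elim: t => [|t IH]; first by rewrite Gam0.
have G0 : 0 < Gam t := lt_le_trans ltr01 IH.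
have th0 := theta_gt0' G0.
have [_ h1 _ _] := theta_bounds t.
rewrite GamE (le_trans IH)// lerDl gammaE; apply: divr_ge0.
  by nonneg.
move: al1; lra.
Qed.

Let Gam_gt0 t : 0 < Gam t. Proof. exact: lt_le_trans ltr01 (Gam_ge1 t). Qed.

Let theta_gt0 t : 0 < theta t.+1. Proof. exact: theta_gt0'. Qed.

Lemma Gam_step t : Gam t = Gam t.+1 * (1 - p * theta t.+1).
Proof.
have [_ h1 _ _] := theta_bounds t.
have : 1 - p * theta t.+1 != 0 by rewrite gt_eqF//; move: al1; lra.
by move=> ne; rewrite GamE gammaE; field.
Qed.

Lemma gamma_step t : gamma t.+1 = p * theta t.+1 * Gam t.+1.
Proof.
have [_ h1 _ _] := theta_bounds t.
have : 1 - p * theta t.+1 != 0 by rewrite gt_eqF//; move: al1; lra.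
by move=> ne; rewrite GamE gammaE; field.
Qed.

Let gamma_gt0 t : 0 < gamma t.+1.
Proof. by rewrite gamma_step !mulr_gt0. Qed.

Let A t := Lbar + Gam t * mu.

Let A_gt0 t : 0 < A t.
Proof. by rewrite ltr_wpDr// mulr_ge0// ltW. Qed.

(** The curvature of the prox objective times gamma_{t+1} is the weight of the distance to xstar at
    the next step, so these weights telescope. *)
Let A_step t : A t + gamma t.+1 * mu = A t.+1.
Proof. by rewrite /A GamE mulrDl addrA. Qed.

(** Below the largest root the quadratic is nonpositive; replacing Gamma_t by Gamma_{t+1} (1 - p
    theta_{t+1}) lets the factor 1 - p theta_{t+1} cancel. *)
Lemma theta_root t : p * Lbar * Gam t.+1 * theta t.+1 ^+ 2 <= A t.
Proof.
have [_ h1 _ _] := theta_bounds t.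
have q0 : 0 < 1 - p * theta t.+1 by move: al1; lra.
have := @step_eq_le R p Lbar mu p0 Lb0 mu0 (Gam t) (thetabar t.+1) (theta t.+1).
rewrite thetaE ge_min lexx -thetaE => /(_ (Gam_gt0 t) (thetabarE t).1 (ltW (theta_gt0 t)) isT).
rewrite /step_eq -/(A t) => H.
rewrite -(ler_pM2l q0).
have e : (1 - p * theta t.+1) * (p * Lbar * Gam t.+1 * theta t.+1 ^+ 2)
  = p * Lbar * Gam t * theta t.+1 ^+ 2 by rewrite [in RHS]Gam_step; ring.
rewrite e; lra.
Qed.

Lemma theta_nincr t : theta t.+2 <= theta t.+1.
Proof.
suff H : thetabar t.+2 <= thetabar t.+1.
  by rewrite !thetaE le_min !ge_min H lexx orbT.
apply: (@step_root_mono R p Lbar mu p0 Lb0 mu0 (Gam t) (Gam t.+1)) => //.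
- by rewrite GamE lerDl ltW.
- exact: (step_root_gt0 p0 Lb0 mu0 (Gam_gt0 _) (thetabarE t).2).
- exact: (step_root_gt0 p0 Lb0 mu0 (Gam_gt0 _) (thetabarE t.+1).2).
- exact: (thetabarE t).1.
- exact: (thetabarE t.+1).1.
Qed.

(** Each member of the maximum is at most Lbar divided by the numerical constant; the two members
    with square roots are compared after squaring. *)
Lemma Lbar_bounds : [/\ L / (alpha * Lbar) <= 1 / 100 / 100,
   L * p / (alpha * tau * Lbar) <= 1 / 100 / 100,
   L * Lm * p ^+ 2 * om * tau / (alpha ^+ 2 * beta ^+ 2 * n%:R * Lbar ^+ 2)
     <= (1 / 100 / 100) ^+ 2 &
   L * Lm * p * om * tau / (alpha ^+ 2 * beta * n%:R * Lbar ^+ 2)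
     <= (1 / 100 / 100) ^+ 2] /\
  (Lm * om * p ^+ 2 / (beta ^+ 2 * n%:R * Lbar) <= 1 / 100 / 100 /\
   Lm * om / (n%:R * Lbar) <= 1 / 100 / 100).
Proof.
move: LbarE; rewrite -/Lm.
set c1 := L / alpha; set c2 := L * p / _; set c3 := Num.sqrt (L * Lm) * p * _ / _.
set c4 := Num.sqrt (L * Lm) * Num.sqrt p * _ / _; set c5 := Lm * om * p ^+ 2 / _.
set c6 := Lm * om / n%:R; set M := Num.max c1 _ => LE.
have C1 : 100 * 100 <= 6605 * 100 + 8 :> R.
  by apply: ler_wpDr => //; apply: ler_wpM2r => //; rewrite ler_nat.
move: C1 LE; move: (6605 * 100 + 8) => C C1 LE.
have C0 : 0 < C by apply: lt_le_trans C1; rewrite mulr_gt0.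
have key a : a <= M -> a / Lbar <= 1 / 100 / 100.
  move=> aM; rewrite ler_pdivrMr//.
  have M0 : 0 < M by rewrite -(pmulr_rgt0 M C0) -LE.
  have := ler_wpM2r (ltW M0) C1; rewrite -LE; lra.
have ne : (alpha != 0) * (beta != 0) * (tau != 0) * (n%:R != 0 :> R) * (Lbar != 0).
  by rewrite !gt_eqF.
have sq a : 0 <= a -> a <= M -> (a / Lbar) ^+ 2 <= (1 / 100 / 100) ^+ 2.
  move=> a0 /key H; rewrite lerXn2r// nnegrE; last by lra.
  by rewrite divr_ge0// ltW.
have LLm : 0 <= L * Lm by rewrite mulr_ge0.
have omt : 0 <= om * tau by rewrite mulr_ge0// ltW.
have s1 : Num.sqrt (L * Lm) ^+ 2 = L * Lm by rewrite sqr_sqrtr.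
have s2 : Num.sqrt (om * tau) ^+ 2 = om * tau by rewrite sqr_sqrtr.
have s3 : Num.sqrt n%:R ^+ 2 = n%:R :> R by rewrite sqr_sqrtr// ltW.
have s4 : Num.sqrt p ^+ 2 = p by rewrite sqr_sqrtr// ltW.
have s5 : Num.sqrt beta ^+ 2 = beta by rewrite sqr_sqrtr// ltW.
have sn : Num.sqrt n%:R != 0 :> R by rewrite gt_eqF// sqrtr_gt0.
have sb : Num.sqrt beta != 0 by rewrite gt_eqF// sqrtr_gt0.
have c30 : 0 <= c3 by rewrite /c3 divr_ge0 ?mulr_ge0 ?sqrtr_ge0// ltW.
have c40 : 0 <= c4 by rewrite /c4 divr_ge0 ?mulr_ge0 ?sqrtr_ge0// ltW.
have c3E : (c3 / Lbar) ^+ 2 =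
    L * Lm * p ^+ 2 * om * tau / (alpha ^+ 2 * beta ^+ 2 * n%:R * Lbar ^+ 2).
  rewrite /c3 !expr_div_n !exprMn s1 s2 s3; field; rewrite !ne//.
have c4E : (c4 / Lbar) ^+ 2 =
    L * Lm * p * om * tau / (alpha ^+ 2 * beta * n%:R * Lbar ^+ 2).
  rewrite /c4 !expr_div_n !exprMn s1 s2 s3 s4 s5; field; rewrite !ne//.
split; first split.
- rewrite (_ : _ / _ = c1 / Lbar); last by rewrite /c1 -[RHS]mulrA -invfM.
  by apply: key; rewrite /M le_max lexx.
- rewrite (_ : _ / _ = c2 / Lbar); last by rewrite /c2 -[RHS]mulrA -invfM.
  by apply: key; rewrite /M !le_max lexx !orbT.
- by rewrite -c3E; apply: sq => //; rewrite /M !le_max lexx !orbT.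
- by rewrite -c4E; apply: sq => //; rewrite /M !le_max lexx !orbT.
split.
- rewrite (_ : _ / _ = c5 / Lbar); last by rewrite /c5 -[RHS]mulrA -invfM.
  by apply: key; rewrite /M !le_max lexx !orbT.
- rewrite (_ : _ / _ = c6 / Lbar); last by rewrite /c6 -[RHS]mulrA -invfM.
  by apply: key; rewrite /M !le_max lexx !orbT.
Qed.

Lemma uE t s : u t.+1 s = prox_pt (A t) (gamma t.+1) mu (g t.+1 s) (u t s) (y t.+1 s).
Proof. by apply: prox_min (umin t s) => //; rewrite A_step. Qed.

Lemma qE t s : q t.+1 s = prox_pt (A t) (gamma t.+1) mu (k t s) (w t s) (y t.+1 s).
Proof. by apply: prox_min (qmin t s) => //; rewrite A_step. Qed.

Lemma zE t s : z t.+1 s = if c t s then x t.+1 s else z t s.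
Proof. by have := kzE t s; case: (c t s) => -[]. Qed.

Lemma kE t s : k t.+1 s = if c t s then v t s else k t s.
Proof. by have := kzE t s; case: (c t s) => -[]. Qed.

Lemma hbar_avg t s : hbar t s = n%:R^-1 *: \sum_i h t i s.
Proof.
elim: t => [|t IH].
  by rewrite hbar_init; congr (_ *: _); apply: eq_bigr => i _; rewrite h_init.
rewrite hbarE IH; under [in RHS]eq_bigr do rewrite hE.
by rewrite big_split -scaler_sumr scalerDr scalerA mulrC.
Qed.

Definition base (t : nat) : nat := (t * (n * 2 + 2))%N.

(** Order of the draws within iteration t: the n compressors of the y-messages, C^P, the coin, the n
    compressors of the z-messages, 2n + 2 sources in all. Distinct workers have distinct ranks, as
    [unbiased_sum] requires. *)
Definition rank (j : src n) : nat :=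
  match j with
  | SrcDy t i => base t + i
  | SrcP t => base t + n
  | SrcCoin t => base t + n + 1
  | SrcDz t i => base t + n + 2 + i
  end%N.

Lemma baseS t : base t.+1 = (base t + n + 2 + n)%N.
Proof. exact: base_succ. Qed.

Local Notation L1 := (L1 P F rank).
Local Notation L2 := (L2 P F rank).
Local Notation ER := (ER P).

Definition square_integrable_state t :=
  [/\ L2 (base t) (u t), L2 (base t) (w t), L2 (base t) (z t), L2 (base t) (k t)
    & L2 (base t) (v t) /\ forall i, L2 (base t) (h t i)].

Lemma L2_gradi r i X : L2 r X -> L2 r (fun s => gf i (X s)).
Proof.
have [Li0 Si] := Lf i.
by apply: (L2_lip hF (sqr_ge0 (Li i))) => a b; exact: (smooth_lip a b Li0 Si).
Qed.

Lemma L2_grad r X : L2 r X -> L2 r (fun s => gavg gf (X s)).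
Proof. by apply: (L2_lip hF (sqr_ge0 L)) => a b; exact: (smooth_lip a b L0 Lsm). Qed.

Lemma L2_prox r (a gm m : R) (X Y Z : T -> vec R d) : L2 r X -> L2 r Y -> L2 r Z ->
  L2 r (fun s => prox_pt a gm m (X s) (Y s) (Z s)).
Proof.
move=> LX LY LZ; apply: L2Z => //; apply: L2B => //; last exact: L2Z.
by apply: L2D => //; exact: L2Z.
Qed.

Local Notation kap := (lyap_kappa L om n%:R alpha p tau beta Lbar).
Local Notation lam := (lyap_lam L alpha p tau Lbar).
Local Notation rho := (lyap_rho L alpha Lbar).
Local Notation nu t := (lyap_nu L alpha p (theta t.+1)).

Definition Psi t : R :=
  ER (fun s => favg f (z t s) - favg f xstar)
  + (kap * ER (fun s => n%:R^-1 * \sum_i sqnorm (h t i s - gf i (z t s)))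
  + nu t * ER (fun s => sqnorm (w t s - u t s))
  + rho * ER (fun s => sqnorm (k t s - gavg gf (z t s)))
  + lam * ER (fun s => sqnorm (v t s - gavg gf (z t s)))).

(** Both bounds come from p Gamma_{t+1} theta^2 / A_{t+1} <= 1/Lbar. The first controls nu_{t+1}
    times the squared step, the second the weight of the noise in the descent inequality. *)
Lemma gamma_ratio t : theta t.+1 ^+ 2 * (gamma t.+1 / A t.+1) ^+ 2 <= (Lbar ^+ 2)^-1
  /\ A t.+1 * (gamma t.+1 / A t.+1) ^+ 2 <= Gam t.+1 * (p / Lbar).
Proof.
have := theta_root t; have AA : A t <= A t.+1.
  by rewrite -A_step lerDl mulr_ge0// ltW.
move=> /le_trans -/(_ _ AA); rewrite gamma_step.
have := A_gt0 t.+1; have := Gam_gt0 t.+1; have := theta_gt0 t.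
move: (A t.+1) (Gam t.+1) (theta t.+1) => a G th th0 G0 a0 H.
have ane : a != 0 by rewrite gt_eqF.
have Lne : Lbar != 0 by rewrite gt_eqF.
have pG0 : 0 <= p * G * th ^+ 2 by apply/ltW; rewrite !mulr_gt0.
have r1 : p * G * th ^+ 2 / a <= Lbar^-1.
  rewrite ler_pdivrMr// ler_pdivlMl//.
  by apply: le_trans H; rewrite le_eqVlt; apply/orP; left; apply/eqP; ring.
have r0 : 0 <= p * G * th ^+ 2 / a by rewrite divr_ge0// ltW.
split.
  have -> : th ^+ 2 * (p * th * G / a) ^+ 2 = (p * G * th ^+ 2 / a) ^+ 2.
    by field.
  by rewrite -exprVn lerXn2r// nnegrE ?invr_ge0 ltW.
have -> : a * (p * th * G / a) ^+ 2 = G * (p * (p * G * th ^+ 2 / a)) by field.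
by rewrite ler_pM2l// ler_pM2l.
Qed.

Lemma nu_nincr t : nu t.+1 <= nu t.
Proof.
rewrite /lyap_nu ler_wpM2l//; last by rewrite lerXn2r ?theta_nincr// nnegrE ltW.
by rewrite mulr_ge0 ?(ltW p0)// divr_ge0 ?(ltW al0)// mulr_ge0.
Qed.

(** * Recursions in expectation over one iteration *)

Section Iteration.
Variable t : nat.
Hypothesis st : square_integrable_state t.
Let b := base t.
Local Notation G := (Gam t).
Local Notation G' := (Gam t.+1).
Local Notation th := (theta t.+1).
Local Notation gm := (gamma t.+1).
Local Notation A' := (A t.+1).
Let Lu : L2 b (u t). Proof. by case: st. Qed.
Let Lw : L2 b (w t). Proof. by case: st. Qed.
Let Lz : L2 b (z t). Proof. by case: st. Qed.
Let Lk : L2 b (k t). Proof. by case: st. Qed.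
Let Lv : L2 b (v t). Proof. by case: st => _ _ _ _ []. Qed.
Let Lh i : L2 b (h t i). Proof. by case: st => _ _ _ _ []. Qed.

(** The ranks below follow the draws: [b] is the start of the iteration, [b + n] follows the
    y-messages, [b + n + 1] the server compressor and [b + n + 2] the coin. In particular y^{t+1}
    and q^{t+1} use none of the randomness of this iteration. *)
Let Ly : L2 b (y t.+1).
Proof. by rewrite (funext (yE t)); apply: L2D => //; exact: L2Z. Qed.

Let Lxi i : L2 b (fun s => gf i (y t.+1 s) - h t i s).
Proof. by apply: L2B => //; exact: L2_gradi. Qed.

Let Lmy i : L2 (b + n)%N (my t i).
Proof.
rewrite (funext (myE t i)).
apply: (compress_L2 hF hI (@mDy t i) (fun a => (@UDy t i a).2) _ _ (Lxi i)).
  by rewrite /= leq_addr.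
by rewrite /= ltn_add2l.
Qed.

Let Lhbar : L2 b (hbar t).
Proof. by rewrite (funext (hbar_avg t)); apply: L2Z => //; exact: L2_sum. Qed.

Let Lg : L2 (b + n)%N (g t.+1).
Proof.
rewrite (funext (gE t)); apply: L2D => //; first exact: L2_mono (leq_addr _ _) Lhbar.
by apply: L2Z => //; exact: L2_sum.
Qed.

Let Lu' : L2 (b + n)%N (u t.+1).
Proof.
by rewrite (funext (uE t)); apply: L2_prox => //; apply: L2_mono (leq_addr _ _) _.
Qed.

Let Lq : L2 b (q t.+1).
Proof. by rewrite (funext (qE t)); exact: L2_prox. Qed.

Let Luq : L2 (b + n)%N (fun s => u t.+1 s - q t.+1 s).
Proof. by apply: L2B => //; exact: L2_mono (leq_addr _ _) Lq. Qed.

Let Lw' : L2 (b + n + 1)%N (w t.+1).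
Proof.
rewrite (funext (wE t)); apply: L2D => //.
  by apply: L2_mono Lq; rewrite -addnA leq_addr.
by apply: (compress_L2 hF hI (@mP t) (@BP t) _ _ Luq); rewrite /= ?addn1.
Qed.

Let Lx : L2 (b + n)%N (x t.+1).
Proof.
rewrite (funext (xE t)); apply: L2D => //; first exact: L2Z.
by apply: L2Z => //; exact: L2_mono (leq_addr _ _) Lz.
Qed.

Let Lz' : L2 (b + n + 2)%N (z t.+1).
Proof.
rewrite (funext (zE t)); apply: (L2_coin hF (Fcoin t) (r := (b + n)%N)) => //=.
- by rewrite -/b addn2 addn1.
- exact: leq_addr.
- exact: L2_mono (leq_addr _ _) Lz.
Qed.

Let Lk' : L2 (b + n + 2)%N (k t.+1).
Proof.
rewrite (funext (kE t)); apply: (L2_coin hF (Fcoin t) (r := b)) => //=.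
- by rewrite -/b addn2 addn1.
- by rewrite -addnA leq_addr.
Qed.

Let Lzi i : L2 (b + n + 2)%N (fun s => gf i (z t.+1 s) - h t i s).
Proof.
by apply: L2B => //; [exact: L2_gradi|apply: L2_mono (Lh i); rewrite -addnA leq_addr].
Qed.

Let Lmz i : L2 (base t.+1) (mz t i).
Proof.
rewrite (funext (mzE t i)).
apply: (compress_L2 hF hI (@mDz t i) (fun a => (@UDz t i a).2) _ _ (Lzi i)).
  by rewrite /= leq_addr.
by rewrite /= baseS ltn_add2l.
Qed.

Lemma state_step : square_integrable_state t.+1.
Proof.
have [le0 le1 le2 le3] := base_le b n; rewrite -/b -baseS in le0 le1 le2 le3.
split; first exact: L2_mono le1 Lu'.
- exact: L2_mono le2 Lw'.
- exact: L2_mono le3 Lz'.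
- exact: L2_mono le3 Lk'.
- split=> [|i].
    rewrite (funext (vE t)); apply: L2D => //; apply: L2Z => //.
      exact: L2_mono le0 Lv.
    apply: L2D => //; first exact: L2_mono le0 Lhbar.
    by apply: L2Z => //; exact: L2_sum.
  rewrite (funext (hE t i)); apply: L2D => //; first exact: L2_mono le0 (Lh i).
  exact: L2Z.
Qed.

Let on := om / n%:R.
Let Ff s := favg f (z t s) - favg f xstar.
Let Hf s := n%:R^-1 * \sum_i sqnorm (h t i s - gf i (z t s)).
Let Kf s := sqnorm (k t s - gavg gf (z t s)).
Let Vf s := sqnorm (v t s - gavg gf (z t s)).
Let Wf s := sqnorm (w t s - u t s).
Let Xf s := sqnorm (u t s - xstar).
Let Uf s := sqnorm (u t.+1 s - u t s).
Let Sf s := sqnorm (u t.+1 s - w t s).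
Let Df s := bregman (favg f) (gavg gf) (z t s) (y t.+1 s).
Let Nf s := n%:R^-1 * \sum_i sqnorm (gf i (y t.+1 s) - h t i s).
Let Mx s := n%:R^-1 * \sum_i sqnorm (gf i (x t.+1 s) - h t i s).
Let Mf s := n%:R^-1 * \sum_i sqnorm (gf i (z t.+1 s) - h t i s).
Let sg := on * ER Nf.

Let L1_avg r (X : 'I_n -> T -> vec R d) : (forall i, L2 r (X i)) ->
  L1 r (fun s => n%:R^-1 * \sum_i sqnorm (X i s)).
Proof. by move=> LX; apply: L1Z; apply: L1_sum => i; exact: L2_sq. Qed.

Let ER_avg r (X : 'I_n -> T -> vec R d) : (forall i, L2 r (X i)) ->
  ER (fun s => n%:R^-1 * \sum_i sqnorm (X i s))
  = n%:R^-1 * \sum_i ER (fun s => sqnorm (X i s)).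
Proof.
move=> LX; have LX2 i := L2_sq (LX i).
by rewrite (ERZ _ (L1_sum _ LX2)) (ER_sum _ LX2).
Qed.

Let LFf : L1 b Ff.
Proof. by apply: L1B; [exact: (L1_smooth hF L0 Lsm Lz)|exact: L1_cst]. Qed.

Let LHf : L1 b Hf.
Proof. by apply: L1_avg => i; apply: L2B => //; exact: L2_gradi. Qed.

Let LKf : L1 b Kf.
Proof. by apply: L2_sq; apply: L2B => //; exact: L2_grad. Qed.

Let LVf : L1 b Vf.
Proof. by apply: L2_sq; apply: L2B => //; exact: L2_grad. Qed.

Let LWf : L1 b Wf.
Proof. by apply: L2_sq; exact: L2B. Qed.

Let LXf : L1 b Xf.
Proof. by apply: L2_sq; apply: L2B => //; exact: L2_cst. Qed.

Let up (X : T -> vec R d) : L2 b X -> L2 (b + n)%N X.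
Proof. exact: L2_mono (leq_addr _ _). Qed.

Let LUf : L1 (b + n)%N Uf.
Proof. by apply: L2_sq; apply: L2B => //; exact: up. Qed.

Let LSf : L1 (b + n)%N Sf.
Proof. by apply: L2_sq; apply: L2B => //; exact: up. Qed.

Let LDf : L1 b Df.
Proof.
rewrite /Df /bregman; apply: L1B.
  by apply: L1B; exact: (L1_smooth hF L0 Lsm).
by apply: L1_dot => //; [exact: L2_grad|exact: L2B].
Qed.

Let LNf : L1 b Nf.
Proof. exact: L1_avg. Qed.

Let LMx : L1 (b + n)%N Mx.
Proof. by apply: L1_avg => i; apply: L2B => //; [exact: L2_gradi|exact: up]. Qed.

Let Ff0 s : 0 <= Ff s. Proof. by rewrite subr_ge0. Qed.
Let avg_ge0 (X : 'I_n -> vec R d) : 0 <= n%:R^-1 * \sum_i sqnorm (X i).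
Proof.
by rewrite mulr_ge0 ?invr_ge0// sumr_ge0// => i _; exact: sqnorm_ge0.
Qed.
Let Df0 s : 0 <= Df s.
Proof. by rewrite /Df yE; exact: (path_D_ge0 cf L0 Lsm). Qed.

Let on0 : 0 <= on. Proof. by rewrite divr_ge0. Qed.
Let sg0 : 0 <= sg.
Proof. by rewrite mulr_ge0// ER_ge0// => s; exact: avg_ge0. Qed.

Let th01 : 0 < th <= 1.
Proof. by rewrite theta_gt0/=; have [] := theta_bounds t; lra. Qed.

(** [sg] bounds the variance of g^{t+1} around the gradient at y^{t+1}; for [Y] known at the start
    of the iteration the noise adds no more than this. *)
Lemma grad_noise (a : R) (Y : T -> vec R d) : L2 b Y ->
  ER (fun s => sqnorm (Y s + a *: (g t.+1 s - gavg gf (y t.+1 s))))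
    <= ER (fun s => sqnorm (Y s)) + a ^+ 2 * sg.
Proof.
move=> LY.
have := @unbiased_sum _ _ _ P _ F rank hF hI d n b (SrcDy t) (CDy t) om (a / n%:R)
  (fun i s => gf i (y t.+1 s) - h t i s) Y (fun i => erefl) (@mDy t) (@UDy t) Lxi LY.
rewrite /sg /Nf (ER_avg Lxi).
have -> : (a / n%:R) ^+ 2 * (om * \sum_i ER (fun s => sqnorm (gf i (y t.+1 s) - h t i s)))
  = a ^+ 2 * (on * (n%:R^-1 * \sum_i ER (fun s => sqnorm (gf i (y t.+1 s) - h t i s)))).
  by rewrite /on; field; rewrite gt_eqF.
apply: le_trans; rewrite le_eqVlt; apply/orP; left; apply/eqP; congr ER; apply/funext => s.
congr (sqnorm (_ + _)); rewrite gE (avg_noise _ _ (hbar_avg t s)) scalerA; congr (_ *: _).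
by apply: eq_bigr => i _; rewrite myE.
Qed.

Lemma noise_le : sg <= on * (4 * Lm * ER Df + 2 * ER Hf).
Proof.
rewrite /sg ler_wpM2l//.
have K := @ER_le_lin _ _ _ P Nf [:: (4 * Lm, Df); (2, Hf)]
  LNf.2 (conj LDf.2 (conj LHf.2 I)).
apply: le_trans (K _) _ => [s|] /=; last by lra.
rewrite addr0 /Nf /Df yE; exact: (path_noise Lf cf).
Qed.

Lemma S_le : ER Sf <= 2 * ER Uf + 2 * ER Wf.
Proof.
have K := @ER_le_lin _ _ _ P Sf [:: (2, Uf); (2, Wf)]
  LSf.2 (conj LUf.2 (conj LWf.2 I)).
apply: le_trans (K _) _ => [s|] /=; last by lra.
rewrite addr0 /Sf /Uf /Wf (sqnormBC (w t s)); exact: sqnormB_le2.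
Qed.

(** [Mf] measures the inputs of the z-compressors, at the new [z] but with the old shifts. Drift
    occurs only when the coin moves [z], hence the factor p. The Young weight [e] stays free,
    because [H_le] and [V_le] need different values. *)
Lemma M_le (e : R) : 0 < e -> ER Mf <= (1 - p) * ER Hf
  + p * ((1 + e) * ER Hf + (1 + e^-1) * (2 * L * Lm * th ^+ 2 * ER Sf + 4 * Lm * ER Df)).
Proof.
move=> e0.
have Mz s : n%:R^-1 * \sum_i sqnorm (gf i (z t s) - h t i s) = Hf s.
  by congr (_ * _); apply: eq_bigr => i _; rewrite sqnormBC.
have -> : Mf = fun s => if c t s then Mx s else Hf s.
  by apply/funext => s; rewrite /Mf zE; case: (c t s) => //; rewrite Mz.
have rc : (b + n <= rank (SrcCoin n t))%N by rewrite /= leq_addr.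
apply: le_trans (ER_coin hF hI (Fcoin t) (Pcoin t) rc LMx (L1_mono (leq_addr _ _) LHf) _ _) _.
- by move=> s; exact: avg_ge0.
- by move=> s; exact: avg_ge0.
rewrite addrC lerD2l ler_wpM2l ?(ltW p0)//.
have K := @ER_le_lin _ _ _ P Mx [:: (1 + e, Hf);
    ((1 + e^-1) * (2 * L * Lm * th ^+ 2), Sf); ((1 + e^-1) * (4 * Lm), Df)]
  LMx.2 (conj LHf.2 (conj LSf.2 (conj LDf.2 I))).
apply: le_trans (K _) _ => [s|] /=; last by lra.
have : Mx s <= (1 + e) * Hf s + (1 + e^-1) * (2 * L * Lm * th ^+ 2 * Sf s + 4 * Lm * Df s).
  by rewrite /Mx /Df xE yE; exact: (path_h Lf cf L0 Lsm).
lra.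
Qed.

Let Hf' s := n%:R^-1 * \sum_i sqnorm (h t.+1 i s - gf i (z t.+1 s)).
Let Kf' s := sqnorm (k t.+1 s - gavg gf (z t.+1 s)).
Let Vf' s := sqnorm (v t.+1 s - gavg gf (z t.+1 s)).
Let Wf' s := sqnorm (w t.+1 s - u t.+1 s).
Let Xf' s := sqnorm (u t.+1 s - xstar).
Let Ff' s := favg f (z t.+1 s) - favg f xstar.
Let Q1 := 2 * L * Lm * th ^+ 2 * ER Sf + 4 * Lm * ER Df.
Let Q2 := 2 * L ^+ 2 * th ^+ 2 * ER Sf + 4 * L * ER Df.
Let tt := (gm / A') ^+ 2.

Let H0 : 0 <= ER Hf. Proof. by apply: ER_ge0 => s; exact: avg_ge0. Qed.
Let K0 : 0 <= ER Kf. Proof. by apply: ER_ge0 => s; exact: sqnorm_ge0. Qed.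
Let V0 : 0 <= ER Vf. Proof. by apply: ER_ge0 => s; exact: sqnorm_ge0. Qed.
Let W0 : 0 <= ER Wf. Proof. by apply: ER_ge0 => s; exact: sqnorm_ge0. Qed.
Let U0 : 0 <= ER Uf. Proof. by apply: ER_ge0 => s; exact: sqnorm_ge0. Qed.
Let S0 : 0 <= ER Sf. Proof. by apply: ER_ge0 => s; exact: sqnorm_ge0. Qed.
Let D0 : 0 <= ER Df. Proof. exact: ER_ge0. Qed.
Let Q10 : 0 <= Q1. Proof. by rewrite /Q1; nonneg. Qed.
Let Q20 : 0 <= Q2. Proof. by rewrite /Q2; nonneg. Qed.

Lemma H_le : ER Hf' <= (1 - beta / 2) * ER Hf + p * (1 + 2 * p / beta) * Q1.
Proof.
have Lh' i : L2 (base t.+1) (fun s => h t.+1 i s - gf i (z t.+1 s)).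
  have [_ _ Lz1 _ [_ Lh1]] := state_step.
  by apply: L2B => //; exact: L2_gradi.
have step i : ER (fun s => sqnorm (h t.+1 i s - gf i (z t.+1 s)))
    <= (1 - beta) * ER (fun s => sqnorm (gf i (z t.+1 s) - h t i s)).
  have rk : (b + n + 2 <= rank (SrcDz t i))%N by rewrite /= leq_addr.
  have := @unbiased_step _ _ _ P _ F rank hF hI d (SrcDz t i) (CDz t i) om (@mDz t i) (@UDz t i)
    (b + n + 2)%N beta _ (fun s => (- (1 - beta)) *: (gf i (z t.+1 s) - h t i s)) rk
    (Lzi i) (L2Z hF _ (Lzi i)).
  have -> : (fun s => sqnorm ((- (1 - beta)) *: (gf i (z t.+1 s) - h t i s)
      + beta *: (CDz t i s (gf i (z t.+1 s) - h t i s) - (gf i (z t.+1 s) - h t i s))))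
      = fun s => sqnorm (h t.+1 i s - gf i (z t.+1 s)).
    apply/funext => s; congr sqnorm; rewrite hE mzE; apply: vecP => j.
    by rewrite !coordE; ring.
  have -> : ER (fun s => sqnorm (- (1 - beta) *: (gf i (z t.+1 s) - h t i s)))
     = (1 - beta) ^+ 2 * ER (fun s => sqnorm (gf i (z t.+1 s) - h t i s)).
    rewrite -(ERZ _ (L2_sq (Lzi i))); congr ER; apply/funext => s.
    by rewrite sqnormZ sqrrN.
  have E0 : 0 <= ER (fun s => sqnorm (gf i (z t.+1 s) - h t i s)).
    by apply: ER_ge0 => s; exact: sqnorm_ge0.
  move=> /le_trans; apply; move: E0; move: (ER _) => E E0.
  rewrite mulrA -mulrDl ler_wpM2r//.
  (* This is where beta <= 1/(omega + 1) is used: (1 - beta)^2 + beta^2 omega <= 1 - beta. *)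
  have := ler_wpM2l (ltW be0) omb; lra.
have HM : ER Hf' <= (1 - beta) * ER Mf.
  rewrite /Hf' (ER_avg Lh') /Mf (ER_avg Lzi) mulrCA ler_wpM2l ?invr_ge0//.
  by rewrite mulr_sumr ler_sum.
(* As drift has probability p, the weight can be as large as beta/(2p): the mean growth factor is
   still only 1 + beta/2. *)
have e0 : 0 < beta / (2 * p) by rewrite divr_gt0// mulr_gt0.
have := M_le e0; rewrite -/Q1 invf_div.
have -> : (1 - p) * ER Hf + p * ((1 + beta / (2 * p)) * ER Hf + (1 + 2 * p / beta) * Q1)
  = (1 + beta / 2) * ER Hf + p * (1 + 2 * p / beta) * Q1
    by field; rewrite !gt_eqF.
move=> M1; apply: le_trans HM _.
have b1 : 0 <= 1 - beta by rewrite subr_ge0.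
apply: le_trans (ler_wpM2l b1 M1) _.
have c0 : 0 <= p * (1 + 2 * p / beta) * Q1.
  apply: mulr_ge0 => //; have := ltW p0; have := ltW be0; move=> *; nonneg.
apply: contract_drift => //; by rewrite (ltW be0) be1.
Qed.

(** The error of v^{t+1} is (1 - tau) times the old error at z^{t+1} plus tau times a centred mean
    of compression errors. The first part contracts despite the drift; the second is charged to
    [Mf]. *)
Lemma V_le : ER Vf' <= (1 - tau / 2) * ER Vf + p * (1 + 2 * p / tau) * Q2
  + tau ^+ 2 * on * (2 * ER Hf + 2 * p * Q1).
Proof.
pose Y s := (1 - tau) *: (v t s - gavg gf (z t.+1 s)).
have LvB : L2 (b + n + 2)%N (fun s => v t s - gavg gf (z t.+1 s)).
  apply: L2B => //; last exact: L2_grad.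
  by apply: L2_mono Lv; rewrite -addnA leq_addr.
have LY : L2 (b + n + 2)%N Y by exact: L2Z.
have := @unbiased_sum _ _ _ P _ F rank hF hI d n (b + n + 2)%N (SrcDz t) (CDz t) om (tau / n%:R)
  (fun i s => gf i (z t.+1 s) - h t i s) Y (fun i => erefl) (@mDz t) (@UDz t) Lzi LY.
have -> : (fun s => sqnorm (Y s + (tau / n%:R) *: \sum_i (CDz t i s (gf i (z t.+1 s) - h t i s)
    - (gf i (z t.+1 s) - h t i s)))) = Vf'.
  apply/funext => s; congr sqnorm; rewrite -scalerA.
  have -> : \sum_i (CDz t i s (gf i (z t.+1 s) - h t i s) - (gf i (z t.+1 s) - h t i s))
     = \sum_i (mz t i s - (gf i (z t.+1 s) - h t i s)).
    by apply: eq_bigr => i _; rewrite mzE.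
  rewrite -(avg_noise _ _ (hbar_avg t s)) -/(gavg gf (z t.+1 s)) vE /Y.
  by apply: vecP => j; rewrite !coordE; ring.
have -> : (tau / n%:R) ^+ 2 * (om * \sum_i ER (fun s => sqnorm (gf i (z t.+1 s) - h t i s)))
  = tau ^+ 2 * on * ER Mf.
  by rewrite /Mf (ER_avg Lzi) /on; field; rewrite gt_eqF.
have -> : ER (fun s => sqnorm (Y s)) =
    (1 - tau) ^+ 2 * ER (fun s => sqnorm (v t s - gavg gf (z t.+1 s))).
  by rewrite -(ERZ _ (L2_sq LvB)); congr ER; apply/funext => s; rewrite sqnormZ.
move=> /le_trans; apply.
have M1 : ER Mf <= 2 * ER Hf + 2 * p * Q1.
  have := M_le ltr01; rewrite -/Q1 invr1.
  have := ler_wpM2r H0 p1; lra.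
apply: lerD; last by rewrite ler_wpM2l// mulr_ge0// sqr_ge0.
have e0 : 0 < tau / (2 * p) by rewrite divr_gt0// mulr_gt0.
pose Vx s := sqnorm (v t s - gavg gf (x t.+1 s)).
have LVx : L1 (b + n)%N Vx.
  by apply: L2_sq; apply: L2B => //; [exact: up|exact: L2_grad].
have e1 : ER (fun s => sqnorm (v t s - gavg gf (z t.+1 s))) <=
    (1 + tau / 2) * ER Vf + p * (1 + 2 * p / tau) * Q2.
  have -> : (fun s => sqnorm (v t s - gavg gf (z t.+1 s))) =
      fun s => if c t s then Vx s else Vf s.
    by apply/funext => s; rewrite zE; case: (c t s).
  have rc : (b + n <= rank (SrcCoin n t))%N by rewrite /= leq_addr.
  apply: le_trans (ER_coin hF hI (Fcoin t) (Pcoin t) rc LVx (L1_mono (leq_addr _ _) LVf) _ _) _.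
  - by move=> s; exact: sqnorm_ge0.
  - by move=> s; exact: sqnorm_ge0.
  have K := @ER_le_lin _ _ _ P Vx [:: (1 + tau / (2 * p), Vf);
      ((1 + (tau / (2 * p))^-1) * (2 * L ^+ 2 * th ^+ 2), Sf);
      ((1 + (tau / (2 * p))^-1) * (4 * L), Df)]
    LVx.2 (conj LVf.2 (conj LSf.2 (conj LDf.2 I))).
  have {}K : ER Vx <= (1 + tau / (2 * p)) * ER Vf + (1 + 2 * p / tau) * Q2.
    rewrite -[2 * p / tau]invf_div; apply: le_trans (K _) _ => [s|] /=; last first.
      by rewrite /Q2 le_eqVlt; apply/orP; left; apply/eqP; ring.
    have : Vx s <= (1 + tau / (2 * p)) * Vf s + (1 + (tau / (2 * p))^-1)
        * (2 * L ^+ 2 * th ^+ 2 * Sf s + 4 * L * Df s).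
      by rewrite /Vx /Df xE yE; exact: (path_v cf L0 Lsm).
    lra.
  apply: le_trans (lerD (ler_wpM2l (ltW p0) K) (lexx _)) _.
  by rewrite le_eqVlt; apply/orP; left; apply/eqP; field; rewrite !gt_eqF.
have t1 : 0 <= 1 - tau by rewrite subr_ge0.
have c0 : 0 <= p * (1 + 2 * p / tau) * Q2.
  apply: mulr_ge0 => //; have := ltW p0; have := ltW tau0; move=> *; nonneg.
apply: le_trans (ler_wpM2l (sqr_ge0 _) e1) _.
apply: contract_sq_drift => //; by rewrite (ltW tau0) tau1.
Qed.

Lemma K_le : ER Kf' <= (1 - p) * ER Kf + 2 * p * ER Vf + 2 * p * Q2.
Proof.
pose Vx s := sqnorm (v t s - gavg gf (x t.+1 s)).
have LVx : L1 (b + n)%N Vx.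
  by apply: L2_sq; apply: L2B => //; [exact: up|exact: L2_grad].
have -> : Kf' = fun s => if c t s then Vx s else Kf s.
  by apply/funext => s; rewrite /Kf' zE kE; case: (c t s).
have rc : (b + n <= rank (SrcCoin n t))%N by rewrite /= leq_addr.
apply: le_trans (ER_coin hF hI (Fcoin t) (Pcoin t) rc LVx (L1_mono (leq_addr _ _) LKf) _ _) _.
- by move=> s; exact: sqnorm_ge0.
- by move=> s; exact: sqnorm_ge0.
have K := @ER_le_lin _ _ _ P Vx [:: (2, Vf); (2 * (2 * L ^+ 2 * th ^+ 2), Sf); (2 * (4 * L), Df)]
  LVx.2 (conj LVf.2 (conj LSf.2 (conj LDf.2 I))).
have {}K : ER Vx <= 2 * ER Vf + 2 * Q2.
  apply: le_trans (K _) _ => [s|] /=; last first.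
    by rewrite /Q2 le_eqVlt; apply/orP; left; apply/eqP; ring.
  have : Vx s <= (1 + 1) * Vf s + (1 + 1^-1) * (2 * L ^+ 2 * th ^+ 2 * Sf s + 4 * L * Df s).
    by rewrite /Vx /Df xE yE; exact: (path_v cf L0 Lsm).
  by rewrite invr1; lra.
exact: mix_arith (ltW p0) K.
Qed.

(** w^{t+1} - u^{t+1} is the error of C^P on u^{t+1} - q^{t+1}, a combination of u^t - w^t and
    g^{t+1} - k^t. The noise of g^{t+1} is separated before Young's inequality, so it enters without
    the factor 1/alpha. *)
Lemma W_le : ER Wf' <= (1 - alpha / 2) * ER Wf
  + 2 / alpha * tt * (2 * ER Kf + 4 * L * ER Df) + tt * sg.
Proof.
have rP : (b + n <= rank (SrcP n t))%N by rewrite /= leqnn.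
have rP' : (rank (SrcP n t) < b + n + 1)%N by rewrite /= addn1.
have [_ E1] := compress_err hF hI (@mP t) (@BP t) rP rP' Luq.
have e1 : Wf' = fun s => sqnorm (CP t s (u t.+1 s - q t.+1 s) - (u t.+1 s - q t.+1 s)).
  by apply/funext => s; rewrite /Wf' wE; congr sqnorm; apply: vecP => j; rewrite !coordE; ring.
rewrite -e1 in E1; apply: le_trans E1 _.
pose kf s := sqnorm (gavg gf (y t.+1 s) - k t s).
have Lkd : L2 b (fun s => gavg gf (y t.+1 s) - k t s).
  by apply: L2B => //; exact: L2_grad.
pose Y s := (A t / A') *: (u t s - w t s) + (- (gm / A')) *: (gavg gf (y t.+1 s) - k t s).
have LY : L2 b Y by apply: L2D => //; apply: L2Z => //; exact: L2B.
have E2 := grad_noise (- (gm / A')) LY.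
have e2 : (fun s => sqnorm (Y s + - (gm / A') *: (g t.+1 s - gavg gf (y t.+1 s)))) =
    fun s => sqnorm (u t.+1 s - q t.+1 s).
  apply/funext => s; congr sqnorm; rewrite uE qE prox_ptB A_step /Y.
  by apply: vecP => j; rewrite !coordE; ring.
rewrite e2 sqrrN -/tt in E2.
have al20 : 0 < alpha / 2 by rewrite divr_gt0.
have AA : (A t / A') ^+ 2 <= 1.
  rewrite -[leRHS](expr1n _ 2) lerXn2r ?nnegrE ?divr_ge0 ?(ltW (A_gt0 _))//.
  by rewrite ler_pdivrMr// mul1r -A_step lerDl mulr_ge0// ltW.
have K := @ER_le_lin _ _ _ P (fun s => sqnorm (Y s)) [:: (1 + alpha / 2, Wf);
    ((1 + (alpha / 2)^-1) * tt * 2, Kf); ((1 + (alpha / 2)^-1) * tt * (4 * L), Df)]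
  (L2_sq LY).2 (conj LWf.2 (conj LKf.2 (conj LDf.2 I))).
have tt0 : 0 <= tt by exact: sqr_ge0.
have c0 : 0 <= 1 + (alpha / 2)^-1 by rewrite addr_ge0// invr_ge0 ltW.
have {}K : ER (fun s => sqnorm (Y s)) <= (1 + alpha / 2) * ER Wf
    + (1 + (alpha / 2)^-1) * tt * (2 * ER Kf + 4 * L * ER Df).
  apply: le_trans (K _) _ => [s|] /=; last first.
    by rewrite le_eqVlt; apply/orP; left; apply/eqP; ring.
  apply: le_trans (sqnormD_young _ _ al20) _.
  rewrite !sqnormZ sqrrN -/tt.
  have h1 : (1 + alpha / 2) * ((A t / A') ^+ 2 * sqnorm (u t s - w t s)) <= (1 + alpha / 2) * Wf s.
    rewrite ler_wpM2l ?addr_ge0 ?(ltW al20)// /Wf (sqnormBC (w t s)).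
    by rewrite ler_piMl// sqnorm_ge0.
  have h2 : sqnorm (gavg gf (y t.+1 s) - k t s) <= 2 * Kf s + 4 * L * Df s.
    by rewrite /Df yE; exact: (path_k cf L0 Lsm).
  have := ler_wpM2l (mulr_ge0 c0 tt0) h2; lra.
have a1 : 0 <= 1 - alpha by rewrite subr_ge0.
apply: le_trans (ler_wpM2l a1 E2) _.
apply: le_trans (ler_wpM2l a1 (lerD K (lexx _))) _.
set Z := 2 * ER Kf + 4 * L * ER Df.
have Z0 : 0 <= tt * Z by rewrite mulr_ge0// addr_ge0// mulr_ge0// mulr_ge0.
have := contract_young al01 W0 Z0 (mulr_ge0 tt0 sg0).
by rewrite (mulrA _ tt Z) (mulrA (2 / alpha) tt Z).
Qed.

(** [ub] is the u-step with the exact gradient, known before the y-messages. The noise is paid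
    twice, once in the distance of u^{t+1} to xstar and once in its distance to [ub], each with
    weight A_{t+1}/2. *)
Lemma F_le : G' * ER Ff' + A' / 2 * ER Xf' <= G * ER Ff + A t / 2 * ER Xf
  + A' * tt * sg - A t / 2 * ER Uf - G' * p * (1 - th) * ER Df
  + G' * p * L * th ^+ 2 / 2 * ER Sf.
Proof.
pose Fx s := favg f (x t.+1 s) - favg f xstar.
have LFx : L1 (b + n)%N Fx by apply: L1B; [exact: (L1_smooth hF L0 Lsm Lx)|exact: L1_cst].
have c1 : ER Ff' <= p * ER Fx + (1 - p) * ER Ff.
  have -> : Ff' = fun s => if c t s then Fx s else Ff s.
    by apply/funext => s; rewrite /Ff' zE; case: (c t s).
  have rc : (b + n <= rank (SrcCoin n t))%N by rewrite /= leq_addr.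
  apply: (ER_coin hF hI (Fcoin t) (Pcoin t) rc LFx (L1_mono (leq_addr _ _) LFf)) => // s.
  by rewrite subr_ge0.
pose ub s := prox_pt (A t) gm mu (gavg gf (y t.+1 s)) (u t s) (y t.+1 s).
have Lub : L2 b ub by apply: L2_prox => //; exact: L2_grad.
have e1 s : u t.+1 s - ub s = (- (gm / A')) *: (g t.+1 s - gavg gf (y t.+1 s)).
  by rewrite uE /ub prox_ptB A_step subrr scaler0 add0r scaleNr.
pose Bf s := sqnorm (ub s - xstar).
have LBx : L2 b (fun s => ub s - xstar) by apply: L2B => //; exact: L2_cst.
have LBf : L1 b Bf := L2_sq LBx.
pose Ef s := sqnorm (u t.+1 s - ub s).
have LEf : L1 (b + n)%N Ef by apply: L2_sq; apply: L2B => //; exact: up.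
have X1 : ER Xf' <= ER Bf + tt * sg.
  have := grad_noise (- (gm / A')) LBx; rewrite sqrrN -/tt.
  apply: le_trans; rewrite le_eqVlt; apply/orP; left; apply/eqP; congr ER.
  by apply/funext => s; rewrite -e1 addrC subrKA.
have E1 : ER Ef <= tt * sg.
  (* With Y = 0 the same bound gives the squared deviation from [ub]. *)
  have := grad_noise (- (gm / A')) (L2_cst P rank hF b 0); rewrite sqrrN -/tt.
  rewrite (_ : ER (fun=> sqnorm 0) = 0); last by rewrite sqnorm0 ER_cst.
  rewrite add0r; apply: le_trans; rewrite le_eqVlt; apply/orP; left; apply/eqP; congr ER.
  by apply/funext => s; rewrite add0r -e1.
have G'0 := ltW (Gam_gt0 t.+1).
have K := @ER_le_lin _ _ _ P (fun s => G' * p * Fx s) [:: (G - G' * (1 - p), Ff);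
    (A t / 2, Xf); (- (A' / 2), Bf); (A' / 2, Ef); (- (A t / 2), Uf);
    (- (G' * p * (1 - th)), Df); (G' * p * L * th ^+ 2 / 2, Sf)]
  (L1Z _ LFx).2 (conj LFf.2 (conj LXf.2 (conj LBf.2 (conj LEf.2 (conj LUf.2
  (conj LDf.2 (conj LSf.2 I))))))).
rewrite (ERZ _ LFx) /= in K.
have A'0 : 0 <= A' / 2 by rewrite divr_ge0// ltW.
have -> : A' * tt * sg = 2 * (A' / 2) * (tt * sg) by field.
apply: (descent_arith2 G'0 A'0 c1 X1 E1 (K _)) => s.
have An : A t + gm * mu != 0 by rewrite A_step gt_eqF.
have i1 : 0 <= gm * mu / 2 * sqnorm (u t.+1 s - y t.+1 s).
  by rewrite mulr_ge0 ?sqnorm_ge0// divr_ge0// mulr_ge0// ltW.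
apply: (descent_arith i1).
have := prox_identity (gavg gf (y t.+1 s)) (u t s) (y t.+1 s) xstar (u t.+1 s) An.
rewrite A_step => <-.
rewrite /Fx /Df xE yE.
exact: (path_main xstar L0 Lsm sc _ _ _ th01 (ltW p0) G'0 (Gam_step t) (gamma_step t)).
Qed.

(** Every expectation in the statement is finite, so the extended-real inequality reduces to the
    real one. *)
Lemma Psi_Expect :
  (Expect P (fun o => favg f (z t o) - favg f xstar)%R
   + kap%:E * Expect P (fun o => n%:R^-1 * \sum_(i < n) sqnorm (h t i o - gf i (z t o)))%R
   + (nu t)%:E * Expect P (fun o => sqnorm (w t o - u t o))%R
   + rho%:E * Expect P (fun o => sqnorm (k t o - gavg gf (z t o)))%R
   + lam%:E * Expect P (fun o => sqnorm (v t o - gavg gf (z t o)))%R = (Psi t)%:E)%E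
  /\ Expect P (fun o => sqnorm (u t o - xstar))%R = (ER (fun o => sqnorm (u t o - xstar)))%:E.
Proof.
split; last exact: (ExpectE LXf).
rewrite (ExpectE LFf) (ExpectE LHf) (ExpectE LKf) (ExpectE LVf) (ExpectE LWf).
by rewrite /Psi -!EFinM -!EFinD !addrA.
Qed.

Lemma lyapunov_step :
  G' * Psi t.+1 + A' / 2 * ER (fun s => sqnorm (u t.+1 s - xstar))
  <= G * Psi t + A t / 2 * ER (fun s => sqnorm (u t s - xstar)).
Proof.
have [th4 pal ptau pbe] := theta_bounds t.
have [[b1 b2 b3 b4] [b5 b6]] := Lbar_bounds.
have [gr1 gr2] := gamma_ratio t.
have tt0 : 0 <= tt by exact: sqr_ge0.
have c0 : 0 <= 8 * L / alpha * p.
  by rewrite mulr_ge0 ?(ltW p0)// divr_ge0 ?(ltW al0)// mulr_ge0.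
have nutt : nu t.+1 * tt <= 8 * p * L / (alpha * Lbar ^+ 2).
  apply: le_trans (ler_wpM2r tt0 (nu_nincr t)) _.
  rewrite [nu t * tt](_ : _ = 8 * L / alpha * p * (th ^+ 2 * tt)); last first.
    by rewrite /lyap_nu mulrA.
  apply: le_trans (ler_wpM2l c0 gr1) _.
  by rewrite le_eqVlt; apply/orP; left; apply/eqP; field; rewrite !gt_eqF.
have sc' := lyap_scalar L0 Lm0 om0 n0 al0 al1 p0 tau0 be0 be1 Lb0 b1 b2 b3 b4 b5 b6
  (theta_gt0 t) th4 pal ptau pbe tt0 nutt erefl (nu_nincr t)
  (lyap_nu_ge0 L0 al0 p0 _) H0 K0 V0 W0 S0 D0 noise_le H_le V_le K_le W_le S_le.
(* Since 4 L <= Lbar, the term - A_t/2 [U] of the descent inequality covers the 2 p theta^2 L [U]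
   that [lyap_scalar] consumes. *)
have hA : 4 * (G' * p * th ^+ 2 * L) <= A t.
  apply: le_trans (theta_root t).
  exact: quarter_scale (ltW (Gam_gt0 t.+1)) (ltW p0) (quarter_bound al0 al1 Lb0 b1).
exact: (lyapunov_arith (ltW (Gam_gt0 t.+1)) (Gam_step t) (ltW p0) gr2 sg0 hA U0 th4 D0 sc' F_le).
Qed.

End Iteration.

Lemma state_all t : square_integrable_state t.
Proof.
elim: t => [|t IH]; last exact: state_step.
rewrite /square_integrable_state.
have -> : u 0%N = fun=> x0 by apply/funext => s; case: (init s) => _ [].
have -> : w 0%N = fun=> x0 by apply/funext => s; case: (init s).
have -> : z 0%N = fun=> x0 by apply/funext => s; case: (init s) => _ [].
have -> : k 0%N = fun=> k0 by apply/funext => s; case: (kv_init s).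
have -> : v 0%N = fun=> v0 by apply/funext => s; case: (kv_init s).
split; try exact: L2_cst.
split=> [|i]; first exact: L2_cst.
by rewrite (_ : h 0%N i = fun=> h0 i); [exact: L2_cst|apply/funext => s; exact: h_init].
Qed.

Lemma lyapunov_exists :
  exists (kappa rho lam : R) (nu : nat -> R),
    0 <= kappa /\ 0 <= rho /\ 0 <= lam /\ (forall t, 0 <= nu t) /\
    forall t : nat,
      let Psi := fun s : nat =>
        (Expect P (fun o => favg f (z s o) - favg f xstar)%R
         + kappa%:E * Expect P (fun o => n%:R^-1 *
                                  \sum_(i < n) sqnorm (h s i o - gf i (z s o)))%R
         + (nu s)%:E * Expect P (fun o => sqnorm (w s o - u s o))%R
         + rho%:E * Expect P (fun o => sqnorm (k s o - gavg gf (z s o)))%R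
         + lam%:E * Expect P (fun o => sqnorm (v s o - gavg gf (z s o)))%R)%E in
      ((Gam t.+1)%:E * Psi t.+1
         + ((Lbar + Gam t.+1 * mu) / 2)%R%:E * Expect P (fun o => sqnorm (u t.+1 o - xstar))%R
       <= (Gam t)%:E * Psi t
         + ((Lbar + Gam t * mu) / 2)%R%:E * Expect P (fun o => sqnorm (u t o - xstar))%R)%E.
Proof.
exists kap, rho, lam, (fun t => nu t); split; first exact: lyap_kappa_ge0.
split; first exact: lyap_rho_ge0.
split; first exact: lyap_lam_ge0.
split; first by move=> t; exact: lyap_nu_ge0.
move=> t /=.
have [-> ->] := Psi_Expect (state_all t.+1); have [-> ->] := Psi_Expect (state_all t).
by rewrite -!EFinM -!EFinD lee_fin; exact: (lyapunov_step (state_all t)).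
Qed.

End Algorithm.

Theorem theorem6
  (R : realType) (dT : measure_display) (T : measurableType dT)
  (P : probability T R)
  (n d : nat) (hn : (0 < n)%N)
  (f : 'I_n -> vec R d -> R) (gf : 'I_n -> vec R d -> vec R d)
  (Li : 'I_n -> R) (L Lhat mu : R) (xstar : vec R d)
  (om alpha p tau beta Gamma0 Lbar thetamin : R)
  (x0 : vec R d) (h0 : 'I_n -> vec R d) (k0 v0 : vec R d)
  (CDy CDz : nat -> 'I_n -> T -> vec R d -> vec R d)
  (CP : nat -> T -> vec R d -> vec R d)
  (c : nat -> T -> bool)
  (F : src n -> set (set T))
  (thetabar theta gamma Gam : nat -> R)
  (y u q w x z k v hbar g : nat -> T -> vec R d)
  (h my mz : nat -> 'I_n -> T -> vec R d) :
  (* Assumption 1 *)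
  (forall i, 0 <= Li i /\ smooth_with (Li i) (f i) (gf i)) ->
  0 < Lhat ->
  (forall x1 x2 : vec R d,
      n%:R^-1 * \sum_(i < n) sqnorm (gf i x1 - gf i x2)
        <= Lhat ^+ 2 * sqnorm (x1 - x2)) ->
  (* Assumption 2 *)
  0 <= L -> smooth_with L (favg f) (gavg gf) ->
  (* Assumption 3 *)
  (forall i, convex_fun (f i)) ->
  0 <= mu -> strongly_convex mu (favg f) ->
  (forall x1, favg f xstar <= favg f x1) ->
  (* Assumption 4: independent sources of randomness *)
  (forall j, sub_sigma (F j)) ->
  mutually_independent P F ->
  (forall t i, random_map_in (F (SrcDy t i)) (CDy t i)) ->
  (forall t i, random_map_in (F (SrcDz t i)) (CDz t i)) ->
  (forall t, random_map_in (F (SrcP n t)) (CP t)) ->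
  (forall t, F (SrcCoin n t) [set s | c t s]) ->
  (* compressors and coins *)
  0 <= om -> 0 < alpha <= 1 ->
  (forall t i, in_U P om (CDy t i)) ->
  (forall t i, in_U P om (CDz t i)) ->
  (forall t, in_B P alpha (CP t)) ->
  0 < p <= 1 ->
  (forall t, P [set s | c t s] = p%:E) ->
  (* parameters *)
  0 < tau <= 1 -> 1 <= Gamma0 ->
  0 < beta -> beta <= 1 / (om + 1) ->
  Lbar = (6605 * 100 + 8) (* = 660508 *) *
    Num.max (L / alpha)
   (Num.max (L * p / (alpha * tau))
   (Num.max (Num.sqrt (L * Lmax_of Li) * p * Num.sqrt (om * tau)
               / (alpha * beta * Num.sqrt n%:R))
   (Num.max (Num.sqrt (L * Lmax_of Li) * Num.sqrt p * Num.sqrt (om * tau)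
               / (alpha * Num.sqrt beta * Num.sqrt n%:R))
   (Num.max (Lmax_of Li * om * p ^+ 2 / (beta ^+ 2 * n%:R))
            (Lmax_of Li * om / n%:R))))) ->
  0 < Lbar ->
  thetamin = 4^-1 * Num.min 1 (Num.min (alpha / p) (Num.min (tau / p) (beta / p))) ->
  (* the scalar sequences of Algorithm 2Direction *)
  Gam 0%N = Gamma0 ->
  (forall t,
     p * Lbar * Gam t * thetabar t.+1 ^+ 2 + p * (Lbar + Gam t * mu) * thetabar t.+1
       - (Lbar + Gam t * mu) = 0 /\
     (forall r, p * Lbar * Gam t * r ^+ 2 + p * (Lbar + Gam t * mu) * r
                  - (Lbar + Gam t * mu) = 0 -> r <= thetabar t.+1)) ->
  (forall t, theta t.+1 = Num.min (thetabar t.+1) thetamin) ->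
  (forall t, gamma t.+1 = p * theta t.+1 * Gam t / (1 - p * theta t.+1)) ->
  (forall t, Gam t.+1 = Gam t + gamma t.+1) ->
  (* initialisation *)
  (forall s, w 0%N s = x0 /\ z 0%N s = x0 /\ u 0%N s = x0) ->
  (forall s i, h 0%N i s = h0 i) ->
  (forall s, k 0%N s = k0 /\ v 0%N s = v0) ->
  (forall s, hbar 0%N s = n%:R^-1 *: \sum_(i < n) h0 i) ->
  (* the iteration *)
  (forall t s, y t.+1 s = theta t.+1 *: w t s + (1 - theta t.+1) *: z t s) ->
  (forall t i s, my t i s = CDy t i s (gf i (y t.+1 s) - h t i s)) ->
  (forall t s, g t.+1 s = hbar t s + n%:R^-1 *: \sum_(i < n) my t i s) ->
  (forall t s (x1 : vec R d),
     prox_obj (g t.+1 s) (Lbar + Gam t * mu) (gamma t.+1) mu (u t s) (y t.+1 s) (u t.+1 s)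
       <= prox_obj (g t.+1 s) (Lbar + Gam t * mu) (gamma t.+1) mu (u t s) (y t.+1 s) x1) ->
  (forall t s (x1 : vec R d),
     prox_obj (k t s) (Lbar + Gam t * mu) (gamma t.+1) mu (w t s) (y t.+1 s) (q t.+1 s)
       <= prox_obj (k t s) (Lbar + Gam t * mu) (gamma t.+1) mu (w t s) (y t.+1 s) x1) ->
  (forall t s, w t.+1 s = q t.+1 s + CP t s (u t.+1 s - q t.+1 s)) ->
  (forall t s, x t.+1 s = theta t.+1 *: u t.+1 s + (1 - theta t.+1) *: z t s) ->
  (forall t s, (k t.+1 s, z t.+1 s) =
                 (if c t s then (v t s, x t.+1 s) else (k t s, z t s))) ->
  (forall t i s, mz t i s = CDz t i s (gf i (z t.+1 s) - h t i s)) ->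
  (forall t i s, h t.+1 i s = h t i s + beta *: mz t i s) ->
  (forall t s, v t.+1 s = (1 - tau) *: v t s
                           + tau *: (hbar t s + n%:R^-1 *: \sum_(i < n) mz t i s)) ->
  (forall t s, hbar t.+1 s = hbar t s + (beta / n%:R) *: \sum_(i < n) mz t i s) ->
  (* conclusion *)
  exists (kappa rho lam : R) (nu : nat -> R),
    0 <= kappa /\ 0 <= rho /\ 0 <= lam /\ (forall t, 0 <= nu t) /\
    forall t : nat,
      let Psi := fun s : nat =>
        (Expect P (fun o => favg f (z s o) - favg f xstar)%R
         + kappa%:E * Expect P (fun o => n%:R^-1 *
                                  \sum_(i < n) sqnorm (h s i o - gf i (z s o)))%R
         + (nu s)%:E * Expect P (fun o => sqnorm (w s o - u s o))%R
         + rho%:E * Expect P (fun o => sqnorm (k s o - gavg gf (z s o)))%R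
         + lam%:E * Expect P (fun o => sqnorm (v s o - gavg gf (z s o)))%R)%E in
      ((Gam t.+1)%:E * Psi t.+1
         + ((Lbar + Gam t.+1 * mu) / 2)%R%:E * Expect P (fun o => sqnorm (u t.+1 o - xstar))%R
       <= (Gam t)%:E * Psi t
         + ((Lbar + Gam t * mu) / 2)%R%:E * Expect P (fun o => sqnorm (u t o - xstar))%R)%E.
Proof.
move=> Lf _ _ L0 Lsm cf mu0 sc xmin hF hI mDy mDz mP Fcoin om0 al01 UDy UDz BP p01 Pcoin
  tau01 Gamma01 be0 beom LbarE Lb0 thetaminE Gam0 thetabarE thetaE gammaE GamE init h_init
  kv_init hbar_init yE myE gE umin qmin wE xE kzE mzE hE vE hbarE.
exact: (lyapunov_exists hn Lf L0 Lsm cf mu0 sc xmin hF hI mDy mDz mP Fcoin om0 al01 UDy UDz BP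
  p01 Pcoin tau01 Gamma01 be0 beom LbarE Lb0 thetaminE Gam0 thetabarE thetaE gammaE GamE init
  h_init kv_init hbar_init yE myE gE umin qmin wE xE kzE mzE hE vE hbarE).
Qed.
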